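(* Let $\alpha,\beta>-1$. The Fourier-space measure associated with the system $\{\varphi_m^{(\alpha,\beta)}\}_{m=0}^\infty$ of tanh-Jacobi functions is $$d\mu_{\alpha,\beta}(\xi)=C_{\alpha,\beta}^2\left|\Gamma\!\left(\frac{\alpha+1}{2}+\frac{i\xi}{2}\right)\Gamma\!\left(\frac{\beta+1}{2}-\frac{i\xi}{2}\right)\right|^2d\xi,\qquad \xi\in\mathbb{R},$$ where $C_{\alpha,\beta}$ is the real constant (up to sign) for which $\mu_{\alpha,\beta}$ has total mass one.
   Context: $P_m^{(\alpha,\beta)}$ is the $m$th Jacobi polynomial in the standard normalisation, $g_m^{(\alpha,\beta)}=\int_{-1}^1(1-t)^\alpha(1+t)^\beta[P_m^{(\alpha,\beta)}(t)]^2\,dt$, and the tanh-Jacobi functions are $$\varphi_m^{(\alpha,\beta)}(x)=\frac{(-1)^m}{\sqrt{g_m^{(\alpha,\beta)}}}(1-\tanh x)^{\frac{\alpha+1}{2}}(1+\tanh x)^{\frac{\beta+1}{2}}P_m^{(\alpha,\beta)}(\tanh x),\qquad m=0,1,2,\ldots,\ x\in\mathbb{R}.$$ Fourier-space measure: a probability measure $d\mu(\xi)=|g(\xi)|^2\,d\xi$ on $\mathbb{R}$, all of whose moments are finite, is the Fourier-space measure associated with a system $\{\varphi_m\}_{m=0}^\infty$ if $g:\mathbb{R}\to\mathbb{C}$ has even real part and odd imaginary part and $$\varphi_m(x)=\frac{i^m}{\sqrt{2\pi}}\int_{-\infty}^\infty g(\xi)\,p_m(\xi)\,e^{ix\xi}\,d\xi,\qquad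 m=0,1,2,\ldots,\ x\in\mathbb{R},$$ where $\{p_m\}_{m=0}^\infty$ are the orthonormal polynomials (with positive leading coefficients) with respect to $d\mu$. *)

(* Defs.v *)
From HB Require Import structures.
From mathcomp Require Import all_boot all_order all_algebra.
From mathcomp Require Import complex.
From mathcomp Require Import all_classical all_reals all_analysis.

Set Implicit Arguments.
Unset Strict Implicit.
Unset Printing Implicit Defensive.

Import Order.TTheory GRing.Theory Num.Theory.
Import numFieldNormedType.Exports.
Import ComplexField.Normc.

Local Open Scope classical_set_scope.
Local Open Scope complex_scope.
Local Open Scope ring_scope.

Section ComplexAnalysis.
Context {R : realType}.
Local Notation leb := (@lebesgue_measure R).

Definition cintegrable (D : set R) (f : R -> R[i]) : Prop :=
  leb.-integrable D (fun t => (complex.Re (f t))%:E) /\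
  leb.-integrable D (fun t => (complex.Im (f t))%:E).

(* Componentwise Lebesgue integral; meaningful when [cintegrable D f]. *)
Definition cintegral (D : set R) (f : R -> R[i]) : R[i] :=
  (\int[leb]_(t in D) complex.Re (f t))
  +i* (\int[leb]_(t in D) complex.Im (f t)).

(* exp (i t) *)
Definition cis (t : R) : R[i] := cos t +i* sin t.

(* t ^ z for t > 0, principal branch *)
Definition cpower (t : R) (z : R[i]) : R[i] :=
  (t `^ complex.Re z)%:C * cis (complex.Im z * ln t).

(* Euler's integral: this is the Gamma function on the half-plane Re z > 0,
   the only region where it is used. *)
Definition cGamma (z : R[i]) : R[i] :=
  cintegral `]0, +oo[ (fun t => cpower t (z - 1) * (expR (- t))%:C).

End ComplexAnalysis.

Section TanhJacobi.
Context {R : realType}.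
Local Notation leb := (@lebesgue_measure R).

Definition tanh (x : R) : R :=
  (expR x - expR (- x)) / (expR x + expR (- x)).

Definition pochhammer (a : R) (k : nat) : R := \prod_(j < k) (a + j%:R).

(* (a+1)_m / m! * 2F1(-m, m+a+b+1; a+1; (1-t)/2), with the factors (a+1)_k
   cancelled: P_m(1) = (a+1)_m / m!. *)
Definition jacobi (a b : R) (m : nat) : {poly R} :=
  \sum_(k < m.+1)
     (pochhammer (m%:R + a + b + 1) k * pochhammer (a + k%:R + 1) (m - k)
        / (k`!%:R * (m - k)`!%:R)) *: (2^-1 *: ('X - 1)) ^+ k.

Definition jacobi_norm (a b : R) (m : nat) : R :=
  \int[leb]_(t in `[-1, 1])
     ((1 - t) `^ a * (1 + t) `^ b * (jacobi a b m).[t] ^+ 2).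

Definition tanh_jacobi (a b : R) (m : nat) (x : R) : R :=
  (-1) ^+ m / Num.sqrt (jacobi_norm a b m)
  * (1 - tanh x) `^ ((a + 1) / 2) * (1 + tanh x) `^ ((b + 1) / 2)
  * (jacobi a b m).[tanh x].

End TanhJacobi.

Section FourierSpaceMeasure.
Context {R : realType}.
Local Notation leb := (@lebesgue_measure R).

Definition has_density (mu : probability (measurableTypeR R) R) (w : R -> R)
    : Prop :=
  forall A : set (measurableTypeR R), measurable A ->
    mu A = (\int[leb]_(xi in A) (w xi)%:E)%E.

Definition finite_moments (mu : probability (measurableTypeR R) R) : Prop :=
  forall k : nat, mu.-integrable setT (fun xi : R => (xi ^+ k)%:E).

Definition orthonormal_polynomials (mu : probability (measurableTypeR R) R)
    (p : nat -> {poly R}) : Prop :=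
  [/\ forall m : nat, size (p m) = m.+1,
      forall m : nat, 0 < lead_coef (p m) &
      forall m n : nat,
        (\int[mu]_xi ((p m).[xi] * (p n).[xi])%:E)%E = ((m == n)%:R)%:E].

Definition is_fourier_space_measure (phi : nat -> R -> R)
    (mu : probability (measurableTypeR R) R) : Prop :=
  finite_moments mu /\
  exists (g : R -> R[i]) (p : nat -> {poly R}),
    [/\ measurable_fun setT (fun xi => complex.Re (g xi)) /\
        measurable_fun setT (fun xi => complex.Im (g xi)),
        has_density mu (fun xi => normc (g xi) ^+ 2),
        (forall xi, complex.Re (g (- xi)) = complex.Re (g xi)) /\
        (forall xi, complex.Im (g (- xi)) = - complex.Im (g xi)),
        orthonormal_polynomials mu p &
        forall (m : nat) (x : R),
          let integrand := fun xi => g xi * (p m).[xi]%:C * cis (x * xi) in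
          cintegrable setT integrand /\
          (phi m x)%:C =
            (0 +i* 1) ^+ m / (Num.sqrt (2 * pi))%:C * cintegral setT integrand].

Definition gamma_weight (a b C xi : R) : R :=
  C ^+ 2 * normc (cGamma ((a + 1) / 2 +i* (xi / 2))
                  * cGamma ((b + 1) / 2 -i* (xi / 2))) ^+ 2.

End FourierSpaceMeasure.

(* Main.v *)
Require Import Defs.
From HB Require Import structures.
From mathcomp Require Import all_boot all_order all_algebra.
From mathcomp Require Import complex.
From mathcomp Require Import all_classical all_reals all_analysis.
From mathcomp Require Import measurable_realfun zify ring lra.

(** Put [a = (alpha + 1) / 2], [b = (beta + 1) / 2] and
    [omega x = (1 - tanh x)^a * (1 + tanh x)^b].  The tanh-Jacobi functions are
    [omega * (q_m \o tanh)], where the [q_m] are the Jacobi polynomials made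
    orthonormal for [(1 - t)^alpha (1 + t)^beta], with signs chosen so that
    [(-1)^m q_m] has positive leading coefficient.

    Differentiation preserves the space of functions [omega * (r \o tanh)], [r]
    a polynomial: it acts on [r] as a first-order operator [L], [tanh_deriv],
    that raises the degree by at most one.  Integration by parts
    makes [L] skew-symmetric for the Jacobi inner product of polynomials, which
    by the substitution [t = tanh x] is the inner product in L^2 of the line of
    the corresponding functions ([jint_skew], [jacobi_norm_jint]).  Skewness has two consequences.  Applied
    to derivatives of Jacobi polynomials it puts their differential equation in
    self-adjoint form, whence their orthogonality ([jacobi_orthogonal]).
    Applied to [L q_m], which has degree [m + 1], it leaves only the neighbours
    of [q_m] in the expansion,
      [L q_m = B_m q_(m+1) - B_(m-1) q_(m-1)] with [B_m > 0]
    ([tanh_deriv_jacobiS]).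

    The Fourier transform turns [L] into multiplication by [i xi], so this
    relation becomes [FT q_m = i^m p_m(xi) FT q_0], where the real polynomials
    [p_m] satisfy the symmetric three-term recurrence with coefficients [B_m]
    ([FT_jacobi_on]).  By Parseval's identity and the orthonormality of the
    [q_m], the [p_m] are orthonormal for [|FT q_0|^2 / (2 pi)]
    ([fourier_poly_orthonormal]), and Fourier inversion of [FT q_m] is the
    representation of the tanh-Jacobi functions by
    [g = FT q_0 / sqrt (2 pi)] ([tanh_class_fourier]).

    There remains to compute [FT q_0], a multiple of the transform of [omega].
    With [t = exp (2 u)] in Euler's integral, [Gamma (a + i xi / 2)] is twice the
    Fourier integral of [exp (2 a u - exp (2 u))].  Hence
    [Gamma (a + i xi / 2) Gamma (b - i xi / 2)] is four times the transform of
    the correlation of two such functions, and translating the variable by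
    [ln (1 + exp (2 x)) / 2] shows that this correlation is a positive multiple
    of [omega] ([cGamma_prod], [ecorrE]).  So [g] is a positive multiple of the
    product of Gamma functions.

    The functions [omega * (r \o tanh)] and their transforms are bounded by a
    multiple of [1 / (1 + x^2)].  Under that bound the inversion formula and
    Parseval's identity follow from the explicit transform of
    [exp (- e |xi|)] and dominated convergence as [e] tends to 0. *)

Set Implicit Arguments.
Unset Strict Implicit.
Unset Printing Implicit Defensive.

Import Order.TTheory GRing.Theory Num.Theory.
Import numFieldNormedType.Exports.

Local Open Scope classical_set_scope.
Local Open Scope ring_scope.

(** * Integration and Fourier inversion on the line *)

Section IntegrationOnTheLine.
Context {R : realType}.
Local Notation leb := (@lebesgue_measure R).
Implicit Types f g : R -> R.

Lemma oneDsqr_gt0 (x : R) : 0 < oneDsqr x.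
Proof. exact: lt_le_trans ltr01 (oneDsqr_ge1 x). Qed.

Lemma integral_oneDsqrV : (\int[leb]_x (oneDsqr x)^-1%:E = pi%:E)%E.
Proof.
rewrite ge0_symfun_integralT; last 3 first.
- by move=> x; rewrite invr_ge0 ltW // oneDsqr_gt0.
- exact: continuous_oneDsqrV.
- by move=> x; rewrite /= /oneDsqr sqrrN.
rewrite -set_itvcy integral0y_oneDsqr -EFinM; congr EFin; by field.
Qed.

Lemma integrable_oneDsqrV M :
  leb.-integrable setT (fun x => (M / oneDsqr x)%:E).
Proof.
have mV : measurable_fun setT (fun x : R => (oneDsqr x)^-1).
  exact: continuous_measurable_fun continuous_oneDsqrV.
suff : leb.-integrable setT (fun x => (oneDsqr x)^-1%:E).
  move=> /(integrableZl measurableT M); apply: eq_integrable => // x _.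
apply/integrableP; split; first exact/measurable_EFinP.
under eq_integral do rewrite /= ger0_norm ?invr_ge0 ?ltW ?oneDsqr_gt0 //.
by rewrite integral_oneDsqrV ltry.
Qed.

Lemma integrable_bounded_by M f : measurable_fun setT f ->
  (forall x, `|f x| <= M / oneDsqr x) -> leb.-integrable setT (EFin \o f).
Proof.
move=> mf fM; apply: le_integrable (integrable_oneDsqrV M) => //.
  exact/measurable_EFinP.
move=> x _ /=; rewrite lee_fin (le_trans (fM x)) //; exact: ler_norm.
Qed.

(** Dominated convergence, with the integrable function [M / oneDsqr x] as the
    common bound of the [f_ n]. *)
Lemma dominated_Rintegral (f_ : nat -> R -> R) f M :
  (forall n, measurable_fun setT (f_ n)) -> measurable_fun setT f ->
  (forall n x, `|f_ n x| <= M / oneDsqr x) ->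
  (forall x, f_ n x @[n --> \oo] --> f x) ->
  \int[leb]_x f_ n x @[n --> \oo] --> \int[leb]_x f x.
Proof.
move=> mf_ mf f_M f_f.
have ff : leb.-integrable setT (EFin \o f).
  apply: (@integrable_bounded_by M) => // x.
  have : `|f_ n x| @[n --> \oo] --> `|f x| by apply: cvg_norm; exact: f_f.
  move=> h; rewrite -(cvg_lim _ h) //; apply: limr_le; first by apply/cvg_ex; eexists; exact: h.
  by near=> n; exact: f_M.
apply: fine_cvg; rewrite fineK; last exact: integrable_fin_num.
apply: (@dominated_cvg _ _ _ leb setT measurableT (fun n => EFin \o f_ n)
  (EFin \o f) (fun x => (M / oneDsqr x)%:E)).
- by move=> n; apply/measurable_EFinP; exact: mf_.
- by move=> x _; apply: cvg_EFin; [exact: nearW|exact: f_f].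
- by [].
- exact: integrable_oneDsqrV.
- by move=> n x _; rewrite lee_fin; exact: f_M.
Unshelve. all: by end_near. Qed.

(** The bound is a product of integrable functions of [x] and of [y], hence
    integrable on the plane. *)
Lemma Fubini_bounded_by (F : R * R -> R) M : measurable_fun setT F ->
  (forall x y, `|F (x, y)| <= M / oneDsqr x / oneDsqr y) ->
  \int[leb]_x (\int[leb]_y F (x, y)) = \int[leb]_y (\int[leb]_x F (x, y)).
Proof.
move=> mF FM.
have Fx x : leb.-integrable setT (fun y => (F (x, y))%:E).
  apply: (@integrable_bounded_by (M / oneDsqr x) (fun y => F (x, y))) => //.
  exact: measurable_fun_pair2.
have Fy y : leb.-integrable setT (fun x => (F (x, y))%:E).
  apply: (@integrable_bounded_by (M / oneDsqr y) (fun x => F (x, y))) => [|x].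
    exact: measurable_fun_pair1.
  by rewrite mulrAC.
have iF : (leb \x leb)%E.-integrable setT (EFin \o F).
  apply/integrable12ltyP; first exact/measurable_EFinP.
  apply: (@le_lt_trans _ _ (\int[leb]_x ((M * pi) / oneDsqr x)%:E)%E); last first.
    by apply: integrable_lty => //; exact: integrable_oneDsqrV.
  apply: ge0_le_integral => //.
  - by move=> x _; exact: integral_ge0.
  - have mF' : measurable_fun setT (abse \o (EFin \o F)).
      by apply: measurableT_comp => //; exact/measurable_EFinP.
    have := @measurable_fun_fubini_tonelli_F _ _ _ _ R leb (abse \o (EFin \o F)) mF'.
    by apply=> z; exact: abse_ge0.
  - by apply: (measurable_int leb); exact: integrable_oneDsqrV.
  - move=> x _.
    have -> : ((M * pi / oneDsqr x)%:E =
               \int[leb]_y ((M / oneDsqr x) / oneDsqr y)%:E)%E.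
      under eq_integral do rewrite EFinM.
      rewrite integralZl //; last first.
        have := integrable_oneDsqrV 1; apply: eq_integrable => // y _.
        by rewrite mul1r.
      by rewrite integral_oneDsqrV -EFinM mulrAC.
    apply: ge0_le_integral => //.
    - by apply: measurableT_comp => //; exact: (measurable_int leb (Fx x)).
    - by apply: (measurable_int leb); exact: integrable_oneDsqrV.
    - by move=> y _; rewrite lee_fin; exact: FM.
rewrite /Rintegral; congr fine.
transitivity (\int[leb]_x \int[leb]_y (F (x, y))%:E)%E.
  by apply: eq_integral => x _; rewrite fineK //; exact: integrable_fin_num.
rewrite (Fubini iF) /=.
by apply: eq_integral => x _; rewrite fineK //; exact: integrable_fin_num.
Qed.

Lemma nondecreasing_itvNnn (u : nat -> R) (v : nat -> R) :
  {homo u : m n / (m <= n)%N >-> n <= m} -> {homo v : m n / (m <= n)%N >-> m <= n} ->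
  nondecreasing_seq (fun n => `[u n, v n]%classic).
Proof.
move=> du dv m n mn; rewrite subsetEset; apply: subset_itv; rewrite bnd_simp.
  exact: du.
exact: dv.
Qed.

(** Transfers a substitution rule from compact intervals to the line: for
    nonnegative integrands both sides are monotone limits. *)
Lemma eq_integral_exhaustion (A B : nat -> set R) (f g : R -> R) :
  nondecreasing_seq A -> nondecreasing_seq B ->
  (forall n, measurable (A n)) -> (forall n, measurable (B n)) ->
  measurable_fun (\bigcup_n A n) f -> measurable_fun (\bigcup_n B n) g ->
  (forall x, 0 <= f x) -> (forall x, 0 <= g x) ->
  (forall n, \int[leb]_(x in A n) (f x)%:E = \int[leb]_(x in B n) (g x)%:E)%E ->
  (\int[leb]_(x in \bigcup_n A n) (f x)%:E = \int[leb]_(x in \bigcup_n B n) (g x)%:E)%E.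
Proof.
move=> ndA ndB mA mB mf mg f0 g0 fg.
have cvgA C (h : R -> R) : nondecreasing_seq C -> (forall n, measurable (C n)) ->
    measurable_fun (\bigcup_n C n) h -> (forall x, 0 <= h x) ->
    (\int[leb]_(x in C n) (h x)%:E @[n --> \oo] -->
      \int[leb]_(x in \bigcup_n C n) (h x)%:E)%E.
  move=> ndC mC mh h0; apply: ge0_nondecreasing_set_cvg_integral => //.
    move=> n; apply/measurable_EFinP.
    by apply: measurable_funS mh; [exact: bigcupT_measurable|exact: bigcup_sup].
  by move=> n x _; rewrite lee_fin.
have cA := cvgA _ _ ndA mA mf f0; have cB := cvgA _ _ ndB mB mg g0.
rewrite -(cvg_lim _ cA)// -(cvg_lim _ cB)//.
by rewrite (_ : (fun n => _) = (fun n => \int[leb]_(x in B n) (g x)%:E)%E) //; exact/funext.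
Qed.

Lemma maxr0_continuous_at (G : R -> R) (x : R) : {for x, continuous G} ->
  {for x, continuous (fun y => Num.max (G y) 0)}.
Proof. by move=> cG; apply: (@continuous_max _ _ G (cst 0)) => //; exact: cst_continuous. Qed.

Lemma integral_pos_neg (D : set R) f :
  (\int[leb]_(x in D) (f x)%:E =
   \int[leb]_(x in D) (Num.max (f x) 0)%:E -
   \int[leb]_(x in D) (Num.max (- f x) 0)%:E)%E.
Proof.
rewrite integralE; congr (_ - _)%E; apply: eq_integral => x _.
  by rewrite funeposE EFin_max.
by rewrite funenegE EFin_max.
Qed.

Lemma derivative_gt0_homo (F F' : R -> R) :
  (forall x : R, is_derive x 1 F (F' x)) -> (forall x, 0 < F' x) ->
  {homo F : x y / x < y}.
Proof.
move=> dF F'0 x y xy.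
have cF : continuous F.
  by move=> z; apply/differentiable_continuous/derivable1_diffP; have [] := dF z.
have [|z _ FF] := @MVT _ F F' x y xy (fun z _ => dF z).
  exact: continuous_subspaceT.
by rewrite -subr_gt0 FF mulr_gt0 // subr_gt0.
Qed.

Lemma bigcup_itvNnn : [set: R] = \bigcup_n `[- n%:R, n%:R]%classic.
Proof.
apply/seteqP; split => // x _; have := archi_boundP (normr_ge0 x); set n := Num.bound _ => xn.
by exists n => //=; rewrite in_itv/=; have := ltW xn; rewrite ler_norml.
Qed.

(** For nonnegative [G], exhaust [D] by the images of the intervals [[- n, n]]
    and use the substitution rule there; the general case follows by
    splitting [G] into its positive and negative parts. *)
Lemma integral_substitution (F F' G : R -> R) (D : set R) :
  (forall x : R, is_derive x 1 F (F' x)) -> continuous F' -> (forall x, 0 < F' x) ->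
  open D -> D = \bigcup_n `[F (- n%:R), F n%:R]%classic ->
  (forall x, D x -> {for x, continuous G}) ->
  (\int[leb]_(x in D) (G x)%:E = \int[leb]_x (G (F x) * F' x)%:E)%E.
Proof.
move=> dF cF' F'0 oD DE.
have cF : continuous F.
  by move=> x; apply/differentiable_continuous/derivable1_diffP; have [] := dF x.
have F'E : derive1 F = F' by apply/funext => x; rewrite derive1E; have [] := dF x.
have incF := derivative_gt0_homo dF F'0.
have incF' : {homo F : x y / x <= y} by exact: ltW_homo.
have DF x : D (F x).
  rewrite DE; have [n [xn nx]] : exists n : nat, - n%:R <= x /\ x <= n%:R.
    have := archi_boundP (normr_ge0 x); set n := Num.bound _ => xn.
    by exists n; split; have := ltW xn; rewrite ler_norml => /andP[].
  by exists n => //=; rewrite in_itv/= !incF'.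
have nonneg (G1 : R -> R) : (forall x, D x -> {for x, continuous G1}) -> (forall x, 0 <= G1 x) ->
  (\int[leb]_(x in D) (G1 x)%:E = \int[leb]_x (G1 (F x) * F' x)%:E)%E.
  move=> cG G0.
  rewrite bigcup_itvNnn DE; apply: eq_integral_exhaustion => //.
  - apply: nondecreasing_itvNnn => m n mn; apply: incF'; rewrite ?lerN2 ler_nat //.
  - by apply: nondecreasing_itvNnn => m n mn; rewrite ?lerN2 ler_nat.
  - rewrite -DE; apply: open_continuous_measurable_fun => // x; rewrite inE; exact: cG.
  - apply: measurable_funTS; apply: continuous_measurable_fun => x.
    by apply: cvgM; [apply: continuous_comp; [exact: cF|exact: cG]|exact: cF'].
  - by move=> x; rewrite mulr_ge0 // ltW.
  move=> n; rewrite (@integration_by_substitution_increasing _ F G1) //.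
  - by apply: eq_integral => x _; rewrite F'E.
  - by rewrite (le_trans _ (ler0n _ n)) // oppr_le0.
  - by move=> x y _ _; exact: incF.
  - by move=> x _; rewrite F'E; exact: cF'.
  - by rewrite F'E; apply/cvg_ex; exists (F' (- n%:R)); apply: cvg_at_right_filter; exact: cF'.
  - by rewrite F'E; apply/cvg_ex; exists (F' n%:R); apply: cvg_at_left_filter; exact: cF'.
  - split.
    + by move=> x _; have [] := dF x.
    + by apply: cvg_at_right_filter; exact: cF.
    + by apply: cvg_at_left_filter; exact: cF.
  - apply: continuous_in_subspaceT => x; rewrite inE => xn.
    by apply: cG; rewrite DE; exists n.
move=> cG; rewrite (integral_pos_neg D) (integral_pos_neg setT) !nonneg //.
- congr (_ - _)%E; apply: eq_integral => x _.
    by rewrite maxr_pMl ?mul0r // ltW.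
  by rewrite maxr_pMl ?mul0r ?mulNr // ltW.
- by move=> x Dx; apply: maxr0_continuous_at; apply: continuousN; exact: cG.
- by move=> x; rewrite le_max lexx orbT.
- by move=> x Dx; apply: maxr0_continuous_at; exact: cG.
- by move=> x; rewrite le_max lexx orbT.
Qed.

Lemma integral_reflection (G : R -> R) : continuous G ->
  (\int[leb]_x (G (- x))%:E = \int[leb]_x (G x)%:E)%E.
Proof.
have nonneg (G1 : R -> R) : continuous G1 -> (forall x, 0 <= G1 x) ->
  (\int[leb]_x (G1 (- x))%:E = \int[leb]_x (G1 x)%:E)%E.
  move=> cG G0.
  have ndE : nondecreasing_seq (fun n : nat => `[- n%:R, n%:R : R]%classic).
    by apply: nondecreasing_itvNnn => m n mn; rewrite ?lerN2 ler_nat.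
  rewrite bigcup_itvNnn; apply: eq_integral_exhaustion => //.
  - apply: measurable_funTS; apply: continuous_measurable_fun => x.
    by apply: continuous_comp; [exact: continuousN|exact: cG].
  - by apply: measurable_funTS; apply: continuous_measurable_fun.
  move=> n; rewrite -[in RHS](opprK n%:R) (integration_by_substitution_oppr _ (G := fun x => G1 x)) //=.
  - by rewrite opprK.
  - by rewrite opprK (le_trans _ (ler0n _ n)) // oppr_le0.
  - exact: continuous_subspaceT.
move=> cG; rewrite (integral_pos_neg setT) [RHS](integral_pos_neg setT) .
rewrite -(nonneg (fun x => Num.max (G x) 0)) -?(nonneg (fun x => Num.max (- G x) 0)) //.
- by move=> x; apply: (@maxr0_continuous_at (fun y => - G y)); apply: continuousN; exact: cG.
- by move=> x; rewrite le_max lexx orbT.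
- by move=> x; apply: maxr0_continuous_at; exact: cG.
- by move=> x; rewrite le_max lexx orbT.
Qed.

Lemma Rintegral_odd (h : R -> R) : continuous h -> (forall x, h (- x) = - h x) ->
  leb.-integrable setT (EFin \o h) -> \int[leb]_x h x = 0.
Proof.
move=> ch oddh ih; have : \int[leb]_x h (- x) = \int[leb]_x h x.
  by rewrite /Rintegral integral_reflection.
under eq_Rintegral do rewrite oddh -mulN1r.
by rewrite RintegralZl // mulN1r => /eqP; rewrite eq_sym -addr_eq0 -mulr2n mulrn_eq0 /= => /eqP.
Qed.

Lemma Rintegral_even (h : R -> R) : continuous h -> (forall x, h (- x) = h x) ->
  leb.-integrable setT (EFin \o h) ->
  \int[leb]_x h x = 2 * \int[leb]_(x in `[0, +oo[) h x.
Proof.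
move=> ch evenh ih.
have ih0 : leb.-integrable `[0, +oo[ (EFin \o h) by exact: integrableS ih.
rewrite -[2]/(fine 2%:E) -fineM //; last exact: integrable_fin_num.
congr fine; rewrite integral_pos_neg (integral_pos_neg `[0, +oo[).
rewrite !ge0_symfun_integralT ?set_itvcy.
- have ip : leb.-integrable `[0, +oo[ (fun x => (Num.max (h x) 0)%:E).
    have := integrable_funepos _ ih0; move/(_ (measurable_itv _)).
    by apply: eq_integrable => // x _; rewrite funeposE EFin_max.
  have fip : (\int[leb]_(x in `[0%R, +oo[) (Num.max (h x) 0)%:E)%E \is a fin_num.
    exact: integrable_fin_num.
  rewrite set_itvcy in fip.
  by rewrite (muleBr _ (fin_num_adde_defr _ fip)).
- by move=> x; rewrite le_max lexx orbT.
- by move=> x; apply: (@maxr0_continuous_at (fun y => - h y)); apply: continuousN; exact: ch.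
- by move=> x; rewrite /= evenh.
- by move=> x; rewrite le_max lexx orbT.
- by move=> x; apply: maxr0_continuous_at; exact: ch.
- by move=> x; rewrite /= evenh.
Qed.

Lemma cvg_Rintegral_exhaustion (A : nat -> set R) (f : R -> R) :
  nondecreasing_seq A -> (forall n, measurable (A n)) ->
  leb.-integrable (\bigcup_n A n) (EFin \o f) ->
  \int[leb]_(x in A n) f x @[n --> \oo] --> \int[leb]_(x in \bigcup_n A n) f x.
Proof.
move=> ndA mA If; have mD := bigcupT_measurable _ mA.
have mf := measurable_int _ If.
apply: fine_cvg; rewrite fineK; last exact: integrable_fin_num.
have -> : (fun n => \int[leb]_(x in A n) (f x)%:E)%E =
          (fun n => \int[leb]_(x in \bigcup_n A n) ((EFin \o f) \_ (A n)) x)%E.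
  apply/funext => n; rewrite -integral_mkcondr; congr (integral _ _ _).
  by rewrite setIC; apply/esym/setIidl; exact: bigcup_sup.
apply: (@dominated_cvg _ _ _ leb _ mD _ _ (fun x => `|(f x)%:E|%E)) => //.
- move=> n; apply/measurable_restrict => //.
    exact: mA.
  by apply: (measurable_funS _ _ mf) => //; exact: subIsetl.
- move=> x [n _ Anx].
  apply: cvg_near_cst; exists n => // m /= nm.
  rewrite patchE mem_set //; have := ndA _ _ nm; rewrite subsetEset; exact.
- exact: integrable_abse.
- move=> n x _; rewrite patchE; by case: ifP => // _; rewrite abse0 abse_ge0.
Qed.

(** The boundary terms of improper integrals, taken at the points [n + 1]. *)
Lemma cvg0_bounded_oneDsqrV (u : nat -> R) N :
  (forall n, `|u n| <= N / oneDsqr n.+1%:R) -> u n @[n --> \oo] --> (0 : R).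
Proof.
move=> uN; have N0 : 0 <= N.
  have := le_trans (normr_ge0 _) (uN 0%N).
  by rewrite pmulr_lge0 // invr_gt0 oneDsqr_gt0.
have cN : N * harmonic n @[n --> \oo] --> (0 : R).
  by rewrite -(mulr0 N); apply: cvgM; [exact: cvg_cst|exact: cvg_harmonic].
apply: norm_cvg0; apply: (squeeze_cvgr _ (cvg_cst 0) cN).
apply: nearW => n; rewrite normr_ge0 (le_trans (uN n)) // ler_wpM2l // /harmonic.
rewrite lef_pV2 ?posrE ?oneDsqr_gt0 // /oneDsqr.
rewrite (le_trans (_ : _ <= n.+1%:R ^+ 2)) // ?lerDr // -natrX ler_nat.
by rewrite expnS leq_pmulr.
Qed.

Lemma FTC_line_antiderivative_vanishing (F f : R -> R) M :
  (forall x : R, is_derive x 1 F (f x)) -> continuous f ->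
  (forall x, `|f x| <= M / oneDsqr x) ->
  (exists N, forall x, `|F x| <= N / oneDsqr x) ->
  \int[leb]_x f x = 0.
Proof.
move=> dF cf fM [N FN].
have cF : continuous F.
  by move=> x; apply/differentiable_continuous/derivable1_diffP; have [] := dF x.
have E : [set: R] = \bigcup_n `[- n.+1%:R, n.+1%:R]%classic.
  apply/seteqP; split => // x _; have := archi_boundP (normr_ge0 x); set n := Num.bound _ => xn.
  exists n => //=; rewrite in_itv/= -ler_norml (le_trans (ltW xn)) // ler_nat.
  exact: leqnSn.
have fi : leb.-integrable (\bigcup_n `[- n.+1%:R, n.+1%:R]%classic) (EFin \o f).
  rewrite -E; apply: (integrable_bounded_by _ fM).
  exact: continuous_measurable_fun.
have nd : nondecreasing_seq (fun n : nat => `[- n.+1%:R, n.+1%:R : R]%classic).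
  by apply: nondecreasing_itvNnn => m n mn; rewrite ?lerN2 ler_nat.
have cvg1 := cvg_Rintegral_exhaustion nd (fun n => measurable_itv _) fi.
rewrite E; apply/esym; rewrite -(cvg_lim _ cvg1) //; apply/esym/cvg_lim => //.
have -> : (fun n : nat => \int[leb]_(x in `[- n.+1%:R, n.+1%:R]) f x) =
  (fun n : nat => F n.+1%:R - F (- n.+1%:R)).
  apply/funext => n; rewrite /Rintegral (@continuous_FTC2 _ f F) //.
  - by rewrite (@lt_trans _ _ 0) // ?oppr_lt0 ltr0n.
  - exact: continuous_subspaceT.
  - split.
    + by move=> x _; have [] := dF x.
    + by apply: cvg_at_right_filter; exact: cF.
    + by apply: cvg_at_left_filter; exact: cF.
  - by move=> x _; rewrite derive1E; have [] := dF x.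
rewrite -(subr0 (0 : R)); apply: cvgB; apply: (@cvg0_bounded_oneDsqrV _ N) => n.
  exact: FN.
by apply: (le_trans (FN _)); rewrite /oneDsqr sqrrN.
Qed.

Lemma FTC_halfline_antiderivative_vanishing (F f : R -> R) M N :
  (forall x : R, is_derive x 1 F (f x)) -> continuous f ->
  (forall x, 0 <= x -> `|f x| <= M / oneDsqr x) ->
  (forall x, 0 <= x -> `|F x| <= N / oneDsqr x) ->
  \int[leb]_(x in `[0, +oo[) f x = - F 0.
Proof.
move=> dF cf fM FN.
have cF : continuous F.
  by move=> x; apply/differentiable_continuous/derivable1_diffP; have [] := dF x.
have E : `[0, +oo[%classic = \bigcup_n `[0 : R, n.+1%:R]%classic.
  apply/seteqP; split => x /=; last by move=> [n _ /=]; rewrite !in_itv/= => /andP[->].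
  rewrite in_itv/= andbT => x0; have := archi_boundP x0; set n := Num.bound _ => xn.
  exists n => //=; rewrite in_itv/= x0 (le_trans (ltW xn)) // ler_nat.
  exact: leqnSn.
have fi : leb.-integrable (\bigcup_n `[0 : R, n.+1%:R]%classic) (EFin \o f).
  rewrite -E; apply: le_integrable (integrableS _ _ _ (integrable_oneDsqrV M)) => //.
    by apply/measurable_EFinP; apply: measurable_funTS; exact: continuous_measurable_fun.
  move=> x; rewrite /= in_itv/= andbT => x0; rewrite lee_fin (le_trans (fM x x0)) //.
  exact: ler_norm.
have nd : nondecreasing_seq (fun n : nat => `[0 : R, n.+1%:R : R]%classic).
  by apply: nondecreasing_itvNnn => m n mn; rewrite ?ler_nat.
have cvg1 := cvg_Rintegral_exhaustion nd (fun n => measurable_itv _) fi.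
rewrite E; apply/esym; rewrite -(cvg_lim _ cvg1) //; apply/esym/cvg_lim => //.
have -> : (fun n : nat => \int[leb]_(x in `[0, n.+1%:R]) f x) =
  (fun n : nat => F n.+1%:R - F 0).
  apply/funext => n; rewrite /Rintegral (@continuous_FTC2 _ f F) //.
  - exact: continuous_subspaceT.
  - split.
    + by move=> x _; have [] := dF x.
    + by apply: cvg_at_right_filter; exact: cF.
    + by apply: cvg_at_left_filter; exact: cF.
  - by move=> x _; rewrite derive1E; have [] := dF x.
rewrite -[X in _ --> X](sub0r (F 0)); apply: cvgB; last exact: cvg_cst.
by apply: (@cvg0_bounded_oneDsqrV _ N) => n; exact: FN.
Qed.

Lemma integrable_scale (f : R -> R) c : leb.-integrable setT (EFin \o f) ->
  leb.-integrable setT (EFin \o (fun x => c * f x)).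
Proof. by move=> /(integrableZl measurableT c); apply: eq_integrable => // x _. Qed.

Lemma integrable_add (f g : R -> R) : leb.-integrable setT (EFin \o f) ->
  leb.-integrable setT (EFin \o g) ->
  leb.-integrable setT (EFin \o (fun x => f x + g x)).
Proof. by move=> If Ig; have := integrableD measurableT If Ig; apply: eq_integrable => // x _. Qed.

Lemma isder_cst (c x : R) : is_derive x 1 (fun _ : R => c) 0.
Proof. exact: is_derive_cst. Qed.

Lemma isder_id (x : R) : is_derive x 1 (fun y : R => y) 1.
Proof. exact: is_derive_id. Qed.

Lemma isder_add (f g : R -> R) (x a b : R) : is_derive x 1 f a -> is_derive x 1 g b ->
  is_derive x 1 (fun y => f y + g y) (a + b).
Proof. by move=> df dg; exact: is_deriveD. Qed.

Lemma isder_opp (f : R -> R) (x a : R) : is_derive x 1 f a ->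
  is_derive x 1 (fun y => - f y) (- a).
Proof. by move=> df; exact: is_deriveN. Qed.

Lemma isder_mul (f g : R -> R) (x a b : R) : is_derive x 1 f a -> is_derive x 1 g b ->
  is_derive x 1 (fun y => f y * g y) (a * g x + f x * b).
Proof.
move=> df dg; have h := is_deriveM df dg; apply: (is_derive_eq h).
by rewrite addrC mulrC.
Qed.

Lemma isder_comp (g f : R -> R) (x a b : R) : is_derive x 1 f a -> is_derive (f x) 1 g b ->
  is_derive x 1 (fun y => g (f y)) (b * a).
Proof. by move=> df dg; exact: is_derive1_comp. Qed.

Lemma isder_eq (f : R -> R) (x a b : R) : is_derive x 1 f a -> a = b ->
  is_derive x 1 f b.
Proof. by move=> df <-. Qed.

Lemma isder_inv (f : R -> R) (x a : R) : f x != 0 -> is_derive x 1 f a ->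
  is_derive x 1 (fun y => (f y)^-1) (- (f x) ^- 2 * a).
Proof. by move=> fx0 df; exact: is_deriveV. Qed.

Lemma isder_scale (c x : R) : is_derive x 1 (fun y : R => c * y) c.
Proof. by apply: isder_eq (isder_mul (isder_cst c x) (isder_id x)) _; rewrite mul0r add0r mulr1. Qed.

Lemma isder_continuous (f f' : R -> R) : (forall x : R, is_derive x 1 f (f' x)) -> continuous f.
Proof.
by move=> df x; apply/differentiable_continuous/derivable1_diffP; have [] := df x.
Qed.

Lemma Rintegral_translation (G : R -> R) c : continuous G ->
  \int[leb]_x G (x + c) = \int[leb]_x G x.
Proof.
move=> cG; rewrite /Rintegral; congr fine.
have dF (x : R) : is_derive x 1 (fun y : R => y + c) (cst 1 x).
  by apply: isder_eq (isder_add (isder_id x) (isder_cst c x)) _; rewrite addr0.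
rewrite (integral_substitution (G := G) (D := setT) dF) //.
- by apply: eq_integral => x _; rewrite mulr1.
- exact: cst_continuous.
- exact: openT.
- apply/seteqP; split => // x _; have := archi_boundP (normr_ge0 (x - c)).
  set n := Num.bound _ => xn; exists n => //=; rewrite in_itv/=.
  by move/ltW: xn; rewrite ler_norml => /andP[n1 n2]; apply/andP; split; lra.
by move=> x _; exact: cG.
Qed.

Lemma Rintegral_affine (G : R -> R) (x e : R) : 0 < e -> continuous G ->
  \int[leb]_y G y = \int[leb]_s (G (x + e * s) * e).
Proof.
move=> e0 cG; rewrite /Rintegral; congr fine.
have dF (s : R) : is_derive s 1 (fun s : R => x + e * s) (cst e s).
  by apply: isder_eq (isder_add (isder_cst x s) (isder_scale e s)) _; rewrite add0r.
rewrite (integral_substitution (G := G) (D := setT) dF) //.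
- exact: cst_continuous.
- exact: openT.
- apply/seteqP; split => // y _; have := archi_boundP (normr_ge0 ((y - x) / e)).
  set n := Num.bound _ => /ltW; rewrite ler_norml => /andP[n1 n2].
  move: n1 n2; rewrite ler_pdivlMr // ler_pdivrMr // => n1 n2.
  by exists n => //=; rewrite in_itv/=; apply/andP; split; lra.
by move=> y _; exact: cG.
Qed.

(** From [exp (y / 2) >= 1 + y / 2] one gets [exp y >= 1 + y^2 / 4]; this is how
    exponential decay enters the class of functions bounded by
    [M / oneDsqr x]. *)
Lemma expRN_bound (d x : R) : 0 < d ->
  expR (- (d * `|x|)) <= (1 + 4 / d ^+ 2) / oneDsqr x.
Proof.
move=> d0; have d4 : 0 <= 4 / d ^+ 2 by rewrite divr_ge0 ?sqr_ge0.
have d4' : 0 <= d ^+ 2 / 4 by rewrite divr_ge0 ?sqr_ge0.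
rewrite ler_pdivlMr ?oneDsqr_gt0 // mulrC expRN ler_pdivrMr ?expR_gt0 //.
apply: (@le_trans _ _ ((1 + 4 / d ^+ 2) * (1 + d ^+ 2 / 4 * x ^+ 2))).
  rewrite /oneDsqr -subr_ge0.
  have -> : (1 + 4 / d ^+ 2) * (1 + d ^+ 2 / 4 * x ^+ 2) - (1 + x ^+ 2) =
    4 / d ^+ 2 + d ^+ 2 / 4 * x ^+ 2 by field; rewrite gt_eqF.
  by rewrite addr_ge0 // mulr_ge0 ?sqr_ge0.
rewrite ler_wpM2l ?addr_ge0 //.
set y := d * `|x|; have y0 : 0 <= y by rewrite mulr_ge0 // ltW.
have -> : d ^+ 2 / 4 * x ^+ 2 = y ^+ 2 / 4.
  by rewrite /y exprMn real_normK ?num_real // mulrAC.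
have -> : y = y / 2 + y / 2 by rewrite -splitr.
rewrite expRD; apply: (@le_trans _ _ ((1 + y / 2) * (1 + y / 2))).
  by rewrite -subr_ge0; have -> : (1 + y / 2) * (1 + y / 2) - (1 + (y / 2 + y / 2) ^+ 2 / 4) = y by field.
by apply: ler_pM; rewrite ?expR_ge1Dx // addr_ge0 // divr_ge0.
Qed.

(** A continuous function that is positive at [x0] stays above [f x0 / 2] on an
    interval. *)
Lemma continuous_Rintegral_gt0 (f : R -> R) (x0 M : R) : continuous f ->
  (forall x, 0 <= f x) -> (forall x, `|f x| <= M / oneDsqr x) -> 0 < f x0 ->
  0 < \int[leb]_x f x.
Proof.
move=> cf f0 fM fx0.
have fi := integrable_bounded_by (continuous_measurable_fun cf) fM.
have [d d0 fd] : exists2 d : R, 0 < d & forall x, x0 < x < x0 + d -> f x0 / 2 < f x.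
  have hf : f x0 / 2 < f x0 by rewrite ltr_pdivrMr // mulr_natr mulr2n ltrDl.
  have /nbhs_ballP[d /= d0 h] : \forall x \near x0, f x0 / 2 < f x.
    exact: cvgr_gt _ (@cf x0) _ hf.
  exists d => // x /andP[x1 x2]; apply: h; rewrite /ball /= ltr_distlC.
  by apply/andP; split => //; lra.
apply: (@lt_le_trans _ _ (\int[leb]_(x in `]x0, x0 + d[) (f x0 / 2))).
  rewrite Rintegral_cst //= lebesgue_measure_itv /= lte_fin ltrDl d0 /=.
  by rewrite mulr_gt0 // ?divr_gt0 // addrAC subrr add0r.
apply: fine_le.
- by rewrite integral_cst //= lebesgue_measure_itv /= lte_fin ltrDl d0 -EFinD -EFinM.
- exact: integrable_fin_num.
apply: (@le_trans _ _ (\int[leb]_(x in `]x0, (x0 + d)%R[) (f x)%:E)%E).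
  apply: ge0_le_integral => //.
  - by move=> x _; rewrite lee_fin divr_ge0 // ltW.
  - by apply/measurable_EFinP; apply: measurable_funTS; exact: continuous_measurable_fun.
  - by move=> x; rewrite /= in_itv/= lee_fin => /fd /ltW.
apply: ge0_subset_integral => //.
  by apply/measurable_EFinP; exact: continuous_measurable_fun.
by move=> x _; rewrite lee_fin.
Qed.

Definition cosT (f : R -> R) (xi : R) : R := \int[leb]_x (f x * cos (xi * x)).
Definition sinT (f : R -> R) (xi : R) : R := \int[leb]_x (f x * sin (xi * x)).

Lemma Rintegral_oneDsqrV M : 0 <= M -> \int[leb]_x (M / oneDsqr x) = M * pi.
Proof.
move=> M0; rewrite RintegralZl //; first by rewrite /Rintegral integral_oneDsqrV.
have := integrable_oneDsqrV 1; apply: eq_integrable => // x _.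
by rewrite mul1r.
Qed.

Lemma bounded_by_ge0 (f : R -> R) M : (forall x, `|f x| <= M / oneDsqr x) -> 0 <= M.
Proof.
move=> fM; have := le_trans (normr_ge0 _) (fM 0).
by rewrite pmulr_lge0 // invr_gt0 oneDsqr_gt0.
Qed.

Lemma le_Rintegral_bounded_by (f : R -> R) M : measurable_fun setT f ->
  (forall x, `|f x| <= M / oneDsqr x) -> `|\int[leb]_x f x| <= M * pi.
Proof.
move=> mf fM; have fi := integrable_bounded_by mf fM.
rewrite -Rintegral_oneDsqrV ?(bounded_by_ge0 fM) //.
rewrite (le_trans (le_normr_Rintegral _ fi)) //; apply: le_Rintegral => //.
- exact: integrable_norm.
- exact: integrable_oneDsqrV.
Qed.

Lemma bounded_by_mul1 (f k : R -> R) M : (forall x, `|f x| <= M / oneDsqr x) ->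
  (forall x, `|k x| <= 1) -> forall x, `|f x * k x| <= M / oneDsqr x.
Proof.
by move=> fM k1 x; rewrite normrM -[leRHS]mulr1 ler_pM.
Qed.

Lemma normr_cos_le1 (x : R) : `|cos x| <= 1.
Proof. by rewrite ler_norml cos_geN1 cos_le1. Qed.

Lemma normr_sin_le1 (x : R) : `|sin x| <= 1.
Proof. by rewrite ler_norml sin_geN1 sin_le1. Qed.

Lemma continuous_scale (c : R) : continuous (fun x : R => c * x).
Proof. by apply: (@isder_continuous _ (cst c)) => x; exact: isder_scale. Qed.

Lemma continuous_cosM (c : R) : continuous (fun x : R => cos (c * x)).
Proof.
move=> x; apply: (@continuous_comp _ _ _ (fun x : R => c * x) cos).
  exact: continuous_scale.
exact: continuous_cos.
Qed.

Lemma continuous_sinM (c : R) : continuous (fun x : R => sin (c * x)).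
Proof.
move=> x; apply: (@continuous_comp _ _ _ (fun x : R => c * x) sin).
  exact: continuous_scale.
exact: continuous_sin.
Qed.

Lemma continuousMf (f g : R -> R) : continuous f -> continuous g ->
  continuous (fun x => f x * g x).
Proof. by move=> cf cg x; apply: cvgM; [exact: cf|exact: cg]. Qed.

Lemma continuousDf (f g : R -> R) : continuous f -> continuous g ->
  continuous (fun x => f x + g x).
Proof. by move=> cf cg x; apply: cvgD; [exact: cf|exact: cg]. Qed.

Section TransformsOfADecayingFunction.
Variables (f : R -> R) (M : R).
Hypotheses (cf : continuous f) (fM : forall x, `|f x| <= M / oneDsqr x).

Lemma integrable_cos xi : leb.-integrable setT (EFin \o (fun x => f x * cos (xi * x))).
Proof.
apply: (integrable_bounded_by (M := M)).
  by apply: continuous_measurable_fun; apply: continuousMf => //; exact: continuous_cosM.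
by apply: bounded_by_mul1 => // x; exact: normr_cos_le1.
Qed.

Lemma integrable_sin xi : leb.-integrable setT (EFin \o (fun x => f x * sin (xi * x))).
Proof.
apply: (integrable_bounded_by (M := M)).
  by apply: continuous_measurable_fun; apply: continuousMf => //; exact: continuous_sinM.
by apply: bounded_by_mul1 => // x; exact: normr_sin_le1.
Qed.

Lemma continuous_cosT : continuous (cosT f).
Proof.
move=> xi; apply: (@continuity_under_integral R _ _ leb (fun xi x => f x * cos (xi * x))
  setT measurableT (xi - 1) (xi + 1) _ _ (fun x => M / oneDsqr x)).
- by move=> y _; exact: integrable_cos.
- apply: aeW => x _ y _; apply: cvgM; first exact: cvg_cst.
  have := @continuous_cosM x y; under eq_fun do rewrite mulrC; exact.
- exact: integrable_oneDsqrV.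
- move=> y _; apply: aeW => x _; apply: (@bounded_by_mul1 f (fun x => cos (y * x))) => // z.
  exact: normr_cos_le1.
- by rewrite inE/= in_itv/=; apply/andP; split; lra.
Qed.

Lemma continuous_sinT : continuous (sinT f).
Proof.
move=> xi; apply: (@continuity_under_integral R _ _ leb (fun xi x => f x * sin (xi * x))
  setT measurableT (xi - 1) (xi + 1) _ _ (fun x => M / oneDsqr x)).
- by move=> y _; exact: integrable_sin.
- apply: aeW => x _ y _; apply: cvgM; first exact: cvg_cst.
  have := @continuous_sinM x y; under eq_fun do rewrite mulrC; exact.
- exact: integrable_oneDsqrV.
- move=> y _; apply: aeW => x _; apply: (@bounded_by_mul1 f (fun x => sin (y * x))) => // z.
  exact: normr_sin_le1.
- by rewrite inE/= in_itv/=; apply/andP; split; lra.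
Qed.

Lemma cosTN (xi : R) : cosT f (- xi) = cosT f xi.
Proof. by apply: eq_Rintegral => x _; rewrite mulNr cosN. Qed.

Lemma sinTN xi : sinT f (- xi) = - sinT f xi.
Proof.
transitivity (\int[leb]_x (-1 * (f x * sin (xi * x)))).
  by apply: eq_Rintegral => x _; rewrite mulN1r (mulNr xi) sinN mulrN.
by rewrite RintegralZl ?mulN1r //; exact: integrable_sin.
Qed.

Lemma le_cosT xi : `|cosT f xi| <= M * pi.
Proof.
apply: le_Rintegral_bounded_by.
  by apply: continuous_measurable_fun; apply: continuousMf => //; exact: continuous_cosM.
by apply: bounded_by_mul1 => // x; exact: normr_cos_le1.
Qed.

Lemma le_sinT xi : `|sinT f xi| <= M * pi.
Proof.
apply: le_Rintegral_bounded_by.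
  by apply: continuous_measurable_fun; apply: continuousMf => //; exact: continuous_sinM.
by apply: bounded_by_mul1 => // x; exact: normr_sin_le1.
Qed.

Variables (f' : R -> R) (M' : R).
Hypotheses (df : forall x : R, is_derive x 1 f (f' x)) (cf' : continuous f')
  (f'M : forall x, `|f' x| <= M' / oneDsqr x).

Let integrable_f'cos xi : leb.-integrable setT (EFin \o (fun x => f' x * cos (xi * x))).
Proof.
apply: (integrable_bounded_by (M := M')).
  by apply: continuous_measurable_fun; apply: continuousMf => //; exact: continuous_cosM.
by apply: bounded_by_mul1 => // x; exact: normr_cos_le1.
Qed.

Let integrable_f'sin xi : leb.-integrable setT (EFin \o (fun x => f' x * sin (xi * x))).
Proof.
apply: (integrable_bounded_by (M := M')).
  by apply: continuous_measurable_fun; apply: continuousMf => //; exact: continuous_sinM.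
by apply: bounded_by_mul1 => // x; exact: normr_sin_le1.
Qed.

Let Rintegral_by_parts (k k' : R -> R) xi : (forall x : R, is_derive x 1 (fun x : R => k (xi * x)) (k' x * xi)) ->
  continuous (fun x : R => k (xi * x)) -> continuous k' ->
  (forall x, `|k (xi * x)| <= 1) -> (forall x, `|k' x| <= 1) ->
  \int[leb]_x (f' x * k (xi * x) + f x * (k' x * xi)) = 0.
Proof.
move=> dk ck ck' k1 k'1.
apply: (@FTC_line_antiderivative_vanishing (fun x => f x * k (xi * x)) _ (M' + M * `|xi|)).
- by move=> x; exact: isder_mul.
- apply: continuousDf; apply: continuousMf => //.
  by apply: continuousMf => //; exact: cst_continuous.
- move=> x; rewrite mulrDl; apply: (le_trans (ler_normD _ _)); apply: lerD.
    exact: (@bounded_by_mul1 f' (fun x => k (xi * x))).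
  by rewrite mulrA normrM mulrAC ler_wpM2r //; exact: (@bounded_by_mul1 f k').
- by exists M => x; exact: (@bounded_by_mul1 f (fun x => k (xi * x))).
Qed.

(** Integration by parts: the product of [f] and [cos (xi x)] vanishes at both
    ends. *)
Lemma cosT_derivative xi : cosT f' xi = xi * sinT f xi.
Proof.
have := @Rintegral_by_parts cos (fun x => - sin (xi * x)) xi.
have dk (x : R) : is_derive x 1 (fun x : R => cos (xi * x)) (- sin (xi * x) * xi).
  exact: (@isder_comp cos (fun x => xi * x)) (isder_scale xi x) (is_derive_cos _).
move=> /(_ dk (continuous_cosM (c := xi))) E; apply/eqP; rewrite -subr_eq0; apply/eqP.
rewrite -E.
- rewrite /cosT /sinT -(RintegralZl _ _ (integrable_sin xi)) //.
  rewrite -RintegralB //; last first.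
    by apply: (@integrable_scale (fun x => f x * sin (xi * x))); exact: integrable_sin.
  by apply: eq_Rintegral => x _; ring.
- by move=> x; apply: (@continuousN _ R^o _ (fun x : R => sin (xi * x))); exact: continuous_sinM.
- by move=> x; exact: normr_cos_le1.
- by move=> x; rewrite normrN; exact: normr_sin_le1.
Qed.

Lemma sinT_derivative xi : sinT f' xi = - (xi * cosT f xi).
Proof.
have := @Rintegral_by_parts sin (fun x => cos (xi * x)) xi.
have dk (x : R) : is_derive x 1 (fun x : R => sin (xi * x)) (cos (xi * x) * xi).
  exact: (@isder_comp sin (fun x => xi * x)) (isder_scale xi x) (is_derive_sin _).
move=> /(_ dk (continuous_sinM (c := xi))) E; apply/eqP; rewrite -addr_eq0; apply/eqP.
rewrite -E.
- rewrite /cosT /sinT -(RintegralZl _ _ (integrable_cos xi)) //.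
  rewrite -RintegralD //; last first.
    by apply: (@integrable_scale (fun x => f x * cos (xi * x))); exact: integrable_cos.
  by apply: eq_Rintegral => x _; ring.
- exact: continuous_cosM.
- by move=> x; exact: normr_sin_le1.
- by move=> x; exact: normr_cos_le1.
Qed.

End TransformsOfADecayingFunction.

Section DecayOfTransforms.
Variables (f f' f'' : R -> R) (M M' M'' : R).
Hypotheses (fM : forall x, `|f x| <= M / oneDsqr x)
  (f'M : forall x, `|f' x| <= M' / oneDsqr x)
  (f''M : forall x, `|f'' x| <= M'' / oneDsqr x).
Hypotheses (df : forall x : R, is_derive x 1 f (f' x))
  (df' : forall x : R, is_derive x 1 f' (f'' x)) (cf'' : continuous f'').

Let cf := isder_continuous df.
Let cf' := isder_continuous df'.

(** The transform of [f''] is [- xi^2] times that of [f], and both transforms are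
    bounded; adding the two bounds gives decay like [1 / (1 + xi^2)]. *)
Lemma cosT_bounded_by xi : `|cosT f xi| <= (M * pi + M'' * pi) / oneDsqr xi.
Proof.
have E : cosT f'' xi = - (xi ^+ 2 * cosT f xi).
  rewrite (cosT_derivative cf' f'M df' cf'' f''M) (sinT_derivative cf fM df cf' f'M).
  by rewrite mulrN mulrA.
rewrite ler_pdivlMr ?oneDsqr_gt0 // /oneDsqr mulrDr mulr1; apply: lerD.
  exact: le_cosT.
have -> : `|cosT f xi| * xi ^+ 2 = `|cosT f'' xi|.
  by rewrite E normrN normrM (ger0_norm (sqr_ge0 _)) mulrC.
exact: le_cosT.
Qed.

Lemma sinT_bounded_by xi : `|sinT f xi| <= (M * pi + M'' * pi) / oneDsqr xi.
Proof.
have E : sinT f'' xi = - (xi ^+ 2 * sinT f xi).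
  rewrite (sinT_derivative cf' f'M df' cf'' f''M) (cosT_derivative cf fM df cf' f'M).
  by rewrite mulrA.
rewrite ler_pdivlMr ?oneDsqr_gt0 // /oneDsqr mulrDr mulr1; apply: lerD.
  exact: le_sinT.
have -> : `|sinT f xi| * xi ^+ 2 = `|sinT f'' xi|.
  by rewrite E normrN normrM (ger0_norm (sqr_ge0 _)) mulrC.
exact: le_sinT.
Qed.

End DecayOfTransforms.

Lemma continuous_expRNnorm (e : R) : continuous (fun xi : R => expR (- (e * `|xi|))).
Proof.
move=> x; apply: (@continuous_comp _ _ _ (fun xi : R => - (e * `|xi|)) expR).
  apply: cvgN; apply: cvgM; [exact: cvg_cst|exact: norm_continuous].
exact: continuous_expR.
Qed.

Lemma poisson_bounded_by (e t x : R) : 0 < e ->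
  `|expR (- (e * `|x|)) * cos (t * x)| <= (1 + 4 / e ^+ 2) / oneDsqr x.
Proof.
move=> e0.
apply: (@bounded_by_mul1 (fun x => expR (- (e * `|x|))) (fun x => cos (t * x))).
  by move=> y; rewrite ger0_norm ?expR_ge0 //; exact: expRN_bound.
by move=> y; exact: normr_cos_le1.
Qed.

(** On the half-line an antiderivative is explicit, and the integrand is even. *)
Lemma poisson_kernel e t : 0 < e ->
  \int[leb]_xi (expR (- (e * `|xi|)) * cos (t * xi)) = 2 * (e / (e ^+ 2 + t ^+ 2)).
Proof.
move=> e0.
have d0 : 0 < e ^+ 2 + t ^+ 2 by rewrite ltr_wpDr ?sqr_ge0 // exprn_gt0.
have ch : continuous (fun xi : R => expR (- (e * `|xi|)) * cos (t * xi)).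
  by apply: continuousMf; [exact: continuous_expRNnorm|exact: continuous_cosM].
have bh x : `|expR (- (e * `|x|)) * cos (t * x)| <= (1 + 4 / e ^+ 2) / oneDsqr x.
  exact: poisson_bounded_by.
rewrite Rintegral_even //; last 2 first.
- by move=> x; rewrite normrN mulrN cosN.
- exact: (integrable_bounded_by (continuous_measurable_fun ch) bh).
congr (2 * _).
pose F (x : R) := expR (- (e * x)) * ((t * sin (t * x) - e * cos (t * x)) / (e ^+ 2 + t ^+ 2)).
have -> : \int[leb]_(xi in `[0, +oo[) (expR (- (e * `|xi|)) * cos (t * xi)) =
  \int[leb]_(xi in `[0, +oo[) (expR (- (e * xi)) * cos (t * xi)).
  by apply: eq_Rintegral => x; rewrite inE/= in_itv/= andbT => x0; rewrite ger0_norm.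
have cexp1 : continuous (fun xi : R => expR (- (e * xi))).
  move=> x; apply: (@continuous_comp _ _ _ (fun xi : R => - (e * xi)) expR).
    by apply: cvgN; apply: cvgM; [exact: cvg_cst|exact: cvg_id].
  exact: continuous_expR.
have dF (x : R) : is_derive x 1 F (expR (- (e * x)) * cos (t * x)).
  rewrite /F.
  have dexp : is_derive x 1 (fun x : R => expR (- (e * x))) (expR (- (e * x)) * - e).
    apply: (@isder_comp expR (fun x => - (e * x))).
    by apply: isder_opp; exact: isder_scale.
  have dsin : is_derive x 1 (fun x : R => sin (t * x)) (cos (t * x) * t).
    exact: (@isder_comp sin (fun x => t * x)) (isder_scale t x) (is_derive_sin _).
  have dcos : is_derive x 1 (fun x : R => cos (t * x)) (- sin (t * x) * t).
    exact: (@isder_comp cos (fun x => t * x)) (isder_scale t x) (is_derive_cos _).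
  apply: isder_eq (isder_mul dexp (isder_mul (isder_add (isder_mul (isder_cst t x) dsin)
    (isder_opp (isder_mul (isder_cst e x) dcos))) (isder_cst (e ^+ 2 + t ^+ 2)^-1 x))) _.
  by field; rewrite gt_eqF.
rewrite (FTC_halfline_antiderivative_vanishing (M := 1 + 4 / e ^+ 2)
  (N := (1 + 4 / e ^+ 2) * ((`|t| + e) / (e ^+ 2 + t ^+ 2))) dF).
- by rewrite /F !mulr0 oppr0 expR0 sin0 cos0 mulr0 sub0r mulr1 mul1r mulNr opprK.
- by apply: continuousMf => //; exact: continuous_cosM.
- by move=> x x0; have := bh x; rewrite (ger0_norm x0).
- move=> x x0; rewrite /F normrM mulrAC; apply: ler_pM => //.
    by have := @expRN_bound e x e0; rewrite (ger0_norm x0) ger0_norm // expR_ge0.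
  rewrite normrM [X in _ * X]ger0_norm ?invr_ge0 ?(ltW d0) // ler_wpM2r ?invr_ge0 ?(ltW d0) //.
  rewrite (le_trans (ler_normB _ _)) // lerD // normrM.
    by rewrite -[leRHS]mulr1 ler_wpM2l // normr_sin_le1.
  by rewrite (gtr0_norm e0) -[leRHS]mulr1 ler_wpM2l ?normr_cos_le1 // ltW.
Qed.

Section FourierInversion.
Variables (f : R -> R) (M K : R).
Hypotheses (cf : continuous f) (fM : forall x, `|f x| <= M / oneDsqr x).
Hypotheses (cosK : forall xi, `|cosT f xi| <= K / oneDsqr xi)
  (sinK : forall xi, `|sinT f xi| <= K / oneDsqr xi).

Lemma inversion_integrandE (x xi : R) :
  cosT f xi * cos (xi * x) + sinT f xi * sin (xi * x) =
  \int[leb]_y (f y * cos ((x - y) * xi)).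
Proof.
rewrite mulrC [X in _ + X]mulrC.
have ic := integrable_cos cf fM xi; have js := integrable_sin cf fM xi.
rewrite -(RintegralZl _ measurableT ic) -(RintegralZl _ measurableT js).
rewrite -RintegralD //; [|exact: integrable_scale..].
apply: eq_Rintegral => y _; rewrite mulrBl cosB (mulrC x) (mulrC y); ring.
Qed.

Lemma inversion_integrand_bounded_by (x xi : R) :
  `|cosT f xi * cos (xi * x) + sinT f xi * sin (xi * x)| <= (K + K) / oneDsqr xi.
Proof.
rewrite mulrDl (le_trans (ler_normD _ _)) // lerD //.
  by apply: (@bounded_by_mul1 (cosT f) (fun xi => cos (xi * x))) => // y; exact: normr_cos_le1.
by apply: (@bounded_by_mul1 (sinT f) (fun xi => sin (xi * x))) => // y; exact: normr_sin_le1.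
Qed.

Lemma continuous_inversion_integrand (x : R) :
  continuous (fun xi => cosT f xi * cos (xi * x) + sinT f xi * sin (xi * x)).
Proof.
apply: continuousDf; apply: continuousMf.
- exact: continuous_cosT fM.
- by have := @continuous_cosM x; under eq_fun do rewrite mulrC.
- exact: continuous_sinT fM.
- by have := @continuous_sinM x; under eq_fun do rewrite mulrC.
Qed.

(** Exchanging the order of integration turns the damped inversion integral into
    the convolution of [f] with the Poisson kernel, written in the variable
    [s = (y - x) / e]. *)
Lemma poisson_smoothing (x e : R) : 0 < e ->
  \int[leb]_xi (expR (- (e * `|xi|)) *
    (cosT f xi * cos (xi * x) + sinT f xi * sin (xi * x))) =
  \int[leb]_s (f (x + e * s) * (2 / oneDsqr s)).
Proof.
move=> e0.
pose F (z : R * R) := expR (- (e * `|z.1|)) * (f z.2 * cos ((x - z.2) * z.1)).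
transitivity (\int[leb]_xi \int[leb]_y F (xi, y)).
  apply: eq_Rintegral => xi _; rewrite inversion_integrandE /F /= RintegralZl //.
  apply: (@integrable_bounded_by M).
    apply: measurable_funM; first exact: continuous_measurable_fun.
    apply: measurableT_comp; first exact: continuous_measurable_fun (@continuous_cos R).
    apply: measurable_funM => //; exact: measurable_funB.
  by apply: (@bounded_by_mul1 f (fun y => cos ((x - y) * xi))) => // y; exact: normr_cos_le1.
rewrite (@Fubini_bounded_by _ ((1 + 4 / e ^+ 2) * M)); last 2 first.
- apply: measurable_funM.
    apply: measurableT_comp => //; apply: measurableT_comp => //.
    by apply: measurable_funM => //; apply: measurableT_comp.
  apply: measurable_funM.
    by apply: measurableT_comp => //; exact: continuous_measurable_fun.
  apply: measurableT_comp; first exact: continuous_measurable_fun (@continuous_cos R).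
  by apply: measurable_funM => //; exact: measurable_funB.
- move=> xi y; rewrite /F /= normrM -mulrA -invfM invfM mulrACA; apply: ler_pM => //.
    rewrite ger0_norm ?expR_ge0 //; exact: expRN_bound.
  by apply: (@bounded_by_mul1 f (fun y => cos ((x - y) * xi))) => // z; exact: normr_cos_le1.
transitivity (\int[leb]_y (f y * (2 * (e / (e ^+ 2 + (x - y) ^+ 2))))).
  apply: eq_Rintegral => y _; rewrite -poisson_kernel // -RintegralZl //.
    by apply: eq_Rintegral => xi _; rewrite /F /=; ring.
  apply: (@integrable_bounded_by (1 + 4 / e ^+ 2)).
    apply: continuous_measurable_fun; apply: continuousMf.
      exact: continuous_expRNnorm.
    exact: continuous_cosM.
  by move=> xi; exact: poisson_bounded_by.
rewrite (@Rintegral_affine _ x e) //.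
  apply: eq_Rintegral => s _.
  have s0 : oneDsqr s != 0 by rewrite gt_eqF // oneDsqr_gt0.
  rewrite -mulrA; congr (_ * _).
  have -> : e ^+ 2 + (x - (x + e * s)) ^+ 2 = e ^+ 2 * oneDsqr s by rewrite /oneDsqr; ring.
  by field; rewrite s0 gt_eqF.
apply: continuousMf => // y; apply: cvgM; first exact: cvg_cst.
apply: cvgM; first exact: cvg_cst.
apply: cvgV; first by rewrite gt_eqF // ltr_wpDr ?sqr_ge0 // exprn_gt0.
apply: cvgD; first exact: cvg_cst.
apply: (@continuous_comp _ _ _ (fun y : R => x - y) (fun u => u ^+ 2)).
  by apply: cvgB; [exact: cvg_cst|exact: cvg_id].
exact: exprn_continuous.
Qed.

(** Both sides of [poisson_smoothing] have limits as [e] tends to 0, by dominated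
    convergence: on the left because the transforms decay, on the right because
    [f] is bounded and the kernel [2 / oneDsqr s] is independent of [e]. *)
Lemma Fourier_inversion (x : R) :
  \int[leb]_xi (cosT f xi * cos (xi * x) + sinT f xi * sin (xi * x)) = 2 * pi * f x.
Proof.
pose e (n : nat) : R := n.+1%:R^-1.
have e0 n : 0 < e n by rewrite invr_gt0 ltr0n.
have cvge : e n @[n --> \oo] --> (0 : R) by exact: cvg_harmonic.
pose k xi := cosT f xi * cos (xi * x) + sinT f xi * sin (xi * x).
have ck : continuous k by exact: continuous_inversion_integrand.
have lim1 : \int[leb]_xi (expR (- (e n * `|xi|)) * k xi) @[n --> \oo] --> \int[leb]_xi k xi.
  apply: (@dominated_Rintegral _ _ (K + K)).
  - move=> n; apply: continuous_measurable_fun; apply: continuousMf => //.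
    exact: continuous_expRNnorm.
  - exact: continuous_measurable_fun.
  - move=> n xi; rewrite mulrC; apply: (@bounded_by_mul1 k (fun xi => expR (- (e n * `|xi|)))).
      exact: inversion_integrand_bounded_by.
    move=> y; rewrite ger0_norm ?expR_ge0 // -expR0 ler_expR oppr_le0 mulr_ge0 // ltW //.
  - move=> xi; rewrite -[X in _ --> X]mul1r; apply: cvgM; last exact: cvg_cst.
    rewrite -expR0; apply: (@continuous_cvg _ _ _ _ _ _ expR 0 (@continuous_expR R 0)).
    rewrite -oppr0; apply: cvgN; rewrite -(mul0r `|xi|).
    by apply: cvgM => //; exact: cvg_cst.
have lim2 : \int[leb]_s (f (x + e n * s) * (2 / oneDsqr s)) @[n --> \oo] -->
    \int[leb]_s (f x * (2 / oneDsqr s)).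
  have m2 : measurable_fun setT (fun s : R => 2 / oneDsqr s).
    by apply: measurable_funM => //; exact: continuous_measurable_fun (@continuous_oneDsqrV R).
  apply: (@dominated_Rintegral _ _ (M * 2)).
  - move=> n; apply: measurable_funM => //; apply: measurableT_comp.
      exact: continuous_measurable_fun.
    by apply: measurable_funD => //; exact: measurable_funM.
  - exact: measurable_funM.
  - move=> n s; rewrite normrM -mulrA [X in _ * X]ger0_norm; last first.
      by rewrite divr_ge0 // ltW // oneDsqr_gt0.
    rewrite ler_wpM2r ?divr_ge0 ?(ltW (oneDsqr_gt0 _)) // (le_trans (fM _)) //.
    by rewrite ler_piMr ?(bounded_by_ge0 fM) // oneDsqrV_le1.
  - move=> s; apply: cvgM; last exact: cvg_cst.
    have h : x + e n * s @[n --> \oo] --> x.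
      rewrite -[X in _ --> X]addr0; apply: cvgD; first exact: cvg_cst.
      by rewrite -(mul0r s); apply: cvgM => //; exact: cvg_cst.
    exact: (cvg_comp _ _ h (@cf x)).
have E : (fun n => \int[leb]_xi (expR (- (e n * `|xi|)) * k xi)) =
    (fun n => \int[leb]_s (f (x + e n * s) * (2 / oneDsqr s))).
  by apply/funext => n; rewrite poisson_smoothing.
rewrite E in lim1; rewrite -/(k _) -(cvg_lim _ lim1) // (cvg_lim _ lim2) //.
rewrite RintegralZl //; last exact: integrable_oneDsqrV.
by rewrite Rintegral_oneDsqrV // mulrC.
Qed.

(** Write the transform of [h] as an integral, exchange, and apply the inversion
    formula to [f]. *)
Lemma Parseval (h : R -> R) N : continuous h ->
  (forall x, `|h x| <= N / oneDsqr x) ->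
  \int[leb]_xi (cosT f xi * cosT h xi + sinT f xi * sinT h xi) =
  2 * pi * \int[leb]_x (f x * h x).
Proof.
move=> ch hN.
pose k x xi := cosT f xi * cos (xi * x) + sinT f xi * sin (xi * x).
pose F (z : R * R) := h z.2 * k z.2 z.1.
have mc : measurable_fun setT (cosT f).
  by apply: continuous_measurable_fun; exact: continuous_cosT fM.
have ms : measurable_fun setT (sinT f).
  by apply: continuous_measurable_fun; exact: continuous_sinT fM.
transitivity (\int[leb]_xi \int[leb]_x F (xi, x)).
  apply: eq_Rintegral => xi _.
  have ic := integrable_cos ch hN xi; have js := integrable_sin ch hN xi.
  rewrite -(RintegralZl _ measurableT ic) -(RintegralZl _ measurableT js).
  rewrite -RintegralD //; [|exact: integrable_scale..].
  by apply: eq_Rintegral => x _; rewrite /F /k /=; ring.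
rewrite (@Fubini_bounded_by _ ((K + K) * N)); last 2 first.
- apply: measurable_funM.
    by apply: measurableT_comp => //; exact: continuous_measurable_fun.
  by apply: measurable_funD; apply: measurable_funM;
    [exact: measurableT_comp| |exact: measurableT_comp|];
    (apply: measurableT_comp; [exact: continuous_measurable_fun (@continuous_cos R)|exact: measurable_funM]) ||
    (apply: measurableT_comp; [exact: continuous_measurable_fun (@continuous_sin R)|exact: measurable_funM]).
- move=> xi x; rewrite /F /= normrM -mulrA -invfM invfM mulrACA mulrC; apply: ler_pM => //.
  exact: inversion_integrand_bounded_by.
rewrite -RintegralZl //.
  by apply: eq_Rintegral => x _; rewrite /F /k /= RintegralZl ?Fourier_inversion //;
    [ring|exact: (integrable_bounded_by
      (continuous_measurable_fun (@continuous_inversion_integrand x))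
      (inversion_integrand_bounded_by x))].
apply: (@integrable_bounded_by (M * N)).
  by apply: continuous_measurable_fun; exact: continuousMf.
move=> x; rewrite normrM mulrAC ler_pM //.
rewrite (le_trans (hN x)) // ler_piMr ?(bounded_by_ge0 hN) // oneDsqrV_le1 //.
Qed.

Lemma continuous_inversion_conjugate (x : R) :
  continuous (fun xi => cosT f xi * sin (xi * x) - sinT f xi * cos (xi * x)).
Proof.
move=> xi; apply: cvgB.
- move: xi; apply: continuousMf; first exact: continuous_cosT fM.
  by have := @continuous_sinM x; under eq_fun do rewrite mulrC.
- move: xi; apply: continuousMf; first exact: continuous_sinT fM.
  by have := @continuous_cosM x; under eq_fun do rewrite mulrC.
Qed.

Lemma inversion_conjugate_bounded_by (x xi : R) :
  `|cosT f xi * sin (xi * x) - sinT f xi * cos (xi * x)| <= (K + K) / oneDsqr xi.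
Proof.
rewrite mulrDl (le_trans (ler_normB _ _)) // lerD //.
  by apply: (@bounded_by_mul1 (cosT f) (fun xi => sin (xi * x))) => // y; exact: normr_sin_le1.
by apply: (@bounded_by_mul1 (sinT f) (fun xi => cos (xi * x))) => // y; exact: normr_cos_le1.
Qed.

(** The imaginary part of the inversion integral: its integrand is odd because
    [f] is real. *)
Lemma Rintegral_inversion_odd (x : R) :
  \int[leb]_xi (cosT f xi * sin (xi * x) - sinT f xi * cos (xi * x)) = 0.
Proof.
apply: Rintegral_odd; first exact: continuous_inversion_conjugate.
  by move=> xi; rewrite cosTN (sinTN cf fM) mulNr sinN cosN; ring.
exact: (integrable_bounded_by
  (continuous_measurable_fun (@continuous_inversion_conjugate x))
  (inversion_conjugate_bounded_by x)).
Qed.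

End FourierInversion.

End IntegrationOnTheLine.

(** * Functions of tanh and the Jacobi inner product *)

Section TanhFunctions.
Context {R : realType}.
Local Notation leb := (@lebesgue_measure R).

Lemma expRDN_gt0 (x : R) : 0 < expR x + expR (- x).
Proof. by rewrite addr_gt0 ?expR_gt0. Qed.

Lemma onem_tanh (x : R) : 1 - tanh x = 2 * expR (- x) / (expR x + expR (- x)).
Proof. by rewrite /tanh; field; rewrite gt_eqF // expRDN_gt0. Qed.

Lemma onep_tanh (x : R) : 1 + tanh x = 2 * expR x / (expR x + expR (- x)).
Proof. by rewrite /tanh; field; rewrite gt_eqF // expRDN_gt0. Qed.

Lemma onem_tanh_gt0 (x : R) : 0 < 1 - tanh x.
Proof. by rewrite onem_tanh divr_gt0 ?expRDN_gt0 // mulr_gt0 // expR_gt0. Qed.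

Lemma onep_tanh_gt0 (x : R) : 0 < 1 + tanh x.
Proof. by rewrite onep_tanh divr_gt0 ?expRDN_gt0 // mulr_gt0 // expR_gt0. Qed.

Lemma normr_tanh_le1 (x : R) : `|tanh x| <= 1.
Proof.
have := onem_tanh_gt0 x; have := onep_tanh_gt0 x => h1 h2.
by rewrite ler_norml; apply/andP; split; lra.
Qed.

Lemma isder_tanh (x : R) : is_derive x 1 tanh (1 - tanh x ^+ 2).
Proof.
have de := is_derive_expR x.
have den : is_derive x 1 (fun x : R => expR (- x)) (- expR (- x)).
  apply: isder_eq (@isder_comp R expR (fun x => - x) _ _ _ (isder_opp (isder_id x)) (is_derive_expR _)) _.
  by rewrite mulrN1.
have n0 : expR x + expR (- x) != 0 by rewrite gt_eqF // expRDN_gt0.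
apply: isder_eq (isder_mul (isder_add de (isder_opp den))
  (isder_inv (f := fun x : R => expR x + expR (- x)) n0 (isder_add de den))) _.
by rewrite /tanh; field.
Qed.

Lemma continuous_tanh : continuous (@tanh R).
Proof. exact: isder_continuous isder_tanh. Qed.

Lemma isder_horner (q : {poly R}) (x : R) : is_derive x 1 (fun x => q.[x]) q^`().[x].
Proof.
elim/poly_ind: q => [|p c IH].
  rewrite deriv0; under eq_fun do rewrite horner0; rewrite horner0; exact: isder_cst.
have -> : (fun x => (p * 'X + c%:P).[x]) = (fun x => p.[x] * x + c).
  by apply/funext => y; rewrite !hornerE.
apply: isder_eq (isder_add (isder_mul IH (isder_id x)) (isder_cst c x)) _.
by rewrite derivD derivM derivX derivC !hornerE.
Qed.

Lemma horner_bounded (q : {poly R}) (t : R) : `|t| <= 1 ->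
  `|q.[t]| <= \sum_(i < size q) `|q`_i|.
Proof.
move=> t1; rewrite horner_coef; apply: (le_trans (ler_norm_sum _ _ _)); apply: ler_sum => i _.
by rewrite normrM normrX ler_piMr // exprn_ile1.
Qed.

Variables a b : R.
Hypotheses (a0 : 0 < a) (b0 : 0 < b).

Definition omega (x : R) : R := (1 - tanh x) `^ a * (1 + tanh x) `^ b.

Lemma omegaE (x : R) : omega x = expR (a * ln (1 - tanh x) + b * ln (1 + tanh x)).
Proof.
by rewrite /omega /powR !gt_eqF ?onem_tanh_gt0 ?onep_tanh_gt0 // -expRD.
Qed.

Lemma omega_gt0 (x : R) : 0 < omega x. Proof. by rewrite omegaE expR_gt0. Qed.

Lemma isder_omega (x : R) :
  is_derive x 1 omega (omega x * ((b - a) - (a + b) * tanh x)).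
Proof.
have -> : omega = fun x => expR (a * ln (1 - tanh x) + b * ln (1 + tanh x)).
  by apply/funext => y; rewrite omegaE.
have dT := isder_tanh x.
have dm : is_derive x 1 (fun x : R => ln (1 - tanh x)) _ :=
  @isder_comp R (@ln R) (fun x => 1 - tanh x) x _ _ (isder_add (isder_cst 1 x) (isder_opp dT))
    (is_derive1_ln (onem_tanh_gt0 x)).
have dp : is_derive x 1 (fun x : R => ln (1 + tanh x)) _ :=
  @isder_comp R (@ln R) (fun x => 1 + tanh x) x _ _ (isder_add (isder_cst 1 x) dT)
    (is_derive1_ln (onep_tanh_gt0 x)).
apply: isder_eq (@isder_comp R expR (fun x => a * ln (1 - tanh x) + b * ln (1 + tanh x)) x _ _
  (isder_add (isder_mul (isder_cst a x) dm) (isder_mul (isder_cst b x) dp)) (is_derive_expR _)) _.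
congr (_ * _); field.
by rewrite !gt_eqF ?onem_tanh_gt0 ?onep_tanh_gt0.
Qed.

Lemma ln_onem_tanh (x : R) : ln (1 - tanh x) <= Num.min (ln 2) (ln 2 - 2 * x).
Proof.
have h := onem_tanh_gt0 x.
have e1 := expR_gt0 x; have e2 := expR_gt0 (- x).
rewrite le_min; apply/andP; split.
  rewrite ler_ln ?posrE //; have := onep_tanh_gt0 x; lra.
have -> : ln 2 - 2 * x = ln (2 * expR (- (2 * x))).
  by rewrite lnM ?posrE ?expR_gt0 // expRK.
rewrite ler_ln ?posrE ?mulr_gt0 ?expR_gt0 // onem_tanh ler_pdivrMr ?expRDN_gt0 //.
rewrite -mulrA ler_pM2l // mulrDr -!expRD.
have -> : - (2 * x) + x = - x by ring.
by rewrite lerDl expR_ge0.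
Qed.

Lemma ln_onep_tanh (x : R) : ln (1 + tanh x) <= Num.min (ln 2) (ln 2 + 2 * x).
Proof.
have h := onep_tanh_gt0 x.
have e1 := expR_gt0 x; have e2 := expR_gt0 (- x).
rewrite le_min; apply/andP; split.
  rewrite ler_ln ?posrE //; have := onem_tanh_gt0 x; lra.
have -> : ln 2 + 2 * x = ln (2 * expR (2 * x)).
  by rewrite lnM ?posrE ?expR_gt0 // expRK.
rewrite ler_ln ?posrE ?mulr_gt0 ?expR_gt0 // onep_tanh ler_pdivrMr ?expRDN_gt0 //.
rewrite -mulrA ler_pM2l // mulrDr -!expRD.
have -> : 2 * x - x = x by ring.
by rewrite lerDr expR_ge0.
Qed.

(** Each factor [1 - tanh x], [1 + tanh x] is at most 2, and one of them is at
    most [2 exp (- 2 |x|)]; so [omega] decays exponentially because [a] and [b]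
    are positive. *)
Lemma omega_bounded_by : exists M : R, forall x, `|omega x| <= M / oneDsqr x.
Proof.
pose d := 2 * Num.min a b.
have d0 : 0 < d by rewrite mulr_gt0 // lt_min a0.
exists (expR ((a + b) * ln 2) * (1 + 4 / d ^+ 2)) => x.
rewrite ger0_norm ?(ltW (omega_gt0 _)) // omegaE.
have := ln_onem_tanh x; have := ln_onep_tanh x; rewrite !le_min.
move=> /andP[p1 p2] /andP[m1 m2].
apply: (@le_trans _ _ (expR ((a + b) * ln 2) * expR (- (d * `|x|)))); last first.
  by rewrite -mulrA ler_wpM2l ?expR_ge0 // expRN_bound.
rewrite -expRD ler_expR.
have [da db] : d <= 2 * a /\ d <= 2 * b.
  by split; rewrite ler_pM2l // ge_min lexx ?orbT.
case: (lerP 0 x) => x0.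
  have := ler_wpM2l (ltW a0) m2; have := ler_wpM2l (ltW b0) p1.
  rewrite ger0_norm //; have := ler_wpM2r x0 da; lra.
have := ler_wpM2l (ltW a0) m1; have := ler_wpM2l (ltW b0) p2.
rewrite ltr0_norm //; have := ler_wnM2r (ltW x0) db; lra.
Qed.

Definition tanh_class (q : {poly R}) (x : R) : R := omega x * q.[tanh x].

(** The derivative of [omega] is [omega] times [(b - a) - (a + b) tanh], and that
    of [tanh] is [1 - tanh^2]. *)
Definition tanh_deriv (q : {poly R}) : {poly R} :=
  (1 - 'X ^+ 2) * q^`() + ((b - a)%:P - (a + b) *: 'X) * q.

Lemma isder_tanh_class q (x : R) :
  is_derive x 1 (tanh_class q) (tanh_class (tanh_deriv q) x).
Proof.
have dq := @isder_comp R (fun t => q.[t]) tanh x _ _ (isder_tanh x) (isder_horner q _).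
apply: isder_eq (isder_mul (isder_omega x) dq) _.
rewrite /tanh_class /tanh_deriv; move: (tanh x) (omega x) => t o.
rewrite !(hornerD, hornerM, hornerN, hornerZ, hornerC, hornerX, hornerXn).
by ring.
Qed.

Lemma continuous_tanh_class q : continuous (tanh_class q).
Proof. exact: isder_continuous (isder_tanh_class q). Qed.

Lemma tanh_class_bounded_by q : exists M : R, forall x, `|tanh_class q x| <= M / oneDsqr x.
Proof.
have [M oM] := omega_bounded_by.
exists (M * \sum_(i < size q) `|q`_i|) => x.
rewrite normrM mulrAC ler_pM //; exact/horner_bounded/normr_tanh_le1.
Qed.

Lemma onem_sqr_tanh (x : R) : 1 - tanh x ^+ 2 = (1 - tanh x) * (1 + tanh x).
Proof. by move: (tanh x) => t; ring. Qed.

Lemma tanh_homo : {homo (@tanh R) : x y / x < y}.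
Proof.
apply: (derivative_gt0_homo isder_tanh) => x.
by rewrite onem_sqr_tanh mulr_gt0 ?onem_tanh_gt0 ?onep_tanh_gt0.
Qed.

Lemma tanh_inj : injective (@tanh R).
Proof.
move=> x y xy; case: (ltrgtP x y) => // h; have := tanh_homo h; by rewrite xy ltxx.
Qed.

(** [tanh] takes infinitely many values. *)
Lemma horner_tanh_eq0 (q : {poly R}) : (forall x, q.[tanh x] = 0) -> q = 0.
Proof.
move=> q0; apply/eqP; apply: contraT => qn0.
have := @max_poly_roots _ q [seq tanh k%:R | k <- iota 0 (size q)] qn0.
rewrite size_map size_iota ltnn; apply.
  by apply/allP => _ /mapP[k _ ->]; rewrite /root q0.
rewrite map_inj_uniq ?iota_uniq // => k l /tanh_inj /eqP.
by rewrite eqr_nat => /eqP.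
Qed.

Lemma omega1 (x : R) : tanh_class 1 x = omega x.
Proof. by rewrite /tanh_class hornerC mulr1. Qed.

(** In the variable [t = tanh x] this is the integral of [r] over [[-1, 1]] for
    the Jacobi weight [(1 - t)^(2 a - 1) (1 + t)^(2 b - 1)]. *)
Definition jint (r : {poly R}) : R := \int[leb]_x (omega x * tanh_class r x).

Lemma omega_tanh_class_bounded_by r :
  exists M : R, forall x, `|omega x * tanh_class r x| <= M / oneDsqr x.
Proof.
have [M oM] := omega_bounded_by; have [N rN] := tanh_class_bounded_by r.
exists (M * N) => x; rewrite normrM -mulrA; apply: ler_pM => //.
by rewrite (le_trans (oM x)) // ler_piMr ?(bounded_by_ge0 oM) // oneDsqrV_le1.
Qed.

Lemma continuous_omega : continuous omega.
Proof. exact: isder_continuous isder_omega. Qed.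

Lemma integrable_omega_tanh_class r :
  leb.-integrable setT (EFin \o (fun x => omega x * tanh_class r x)).
Proof.
have [M rM] := omega_tanh_class_bounded_by r.
apply: integrable_bounded_by rM; apply: continuous_measurable_fun.
by apply: continuousMf; [exact: continuous_omega|exact: continuous_tanh_class].
Qed.

Lemma tanh_classD p q x : tanh_class (p + q) x = tanh_class p x + tanh_class q x.
Proof. by rewrite /tanh_class hornerD mulrDr. Qed.

Lemma tanh_classZ c q x : tanh_class (c *: q) x = c * tanh_class q x.
Proof. by rewrite /tanh_class hornerZ mulrCA. Qed.

Lemma jintD p q : jint (p + q) = jint p + jint q.
Proof.
rewrite /jint -RintegralD //; [|exact: integrable_omega_tanh_class..].
by apply: eq_Rintegral => x _; rewrite tanh_classD mulrDr.
Qed.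

Lemma jintZ c q : jint (c *: q) = c * jint q.
Proof.
rewrite /jint -RintegralZl //; last exact: integrable_omega_tanh_class.
by apply: eq_Rintegral => x _; rewrite tanh_classZ mulrCA.
Qed.

Lemma jintM p q : jint (p * q) = \int[leb]_x (tanh_class p x * tanh_class q x).
Proof. by apply: eq_Rintegral => x _; rewrite /tanh_class hornerM; ring. Qed.

(** The integral over the line of the derivative of
    [tanh_class p * tanh_class q] vanishes. *)
Lemma jint_skew p q : jint (tanh_deriv p * q) = - jint (p * tanh_deriv q).
Proof.
apply/eqP; rewrite -addr_eq0 -jintD; apply/eqP.
have [M M1] := omega_tanh_class_bounded_by (p * q).
have [N N1] := omega_tanh_class_bounded_by (tanh_deriv p * q + p * tanh_deriv q).
apply: (@FTC_line_antiderivative_vanishing R (fun x => omega x * tanh_class (p * q) x) _ N) => //.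
- move=> x.
  have -> : (fun x => omega x * tanh_class (p * q) x) =
      (fun x => tanh_class p x * tanh_class q x).
    by apply/funext => y; rewrite /tanh_class hornerM; ring.
  apply: isder_eq (isder_mul (isder_tanh_class p x) (isder_tanh_class q x)) _.
  rewrite /tanh_class hornerD !hornerM.
by move: (tanh x) (omega x) => t o; ring.
- by apply: continuousMf; [exact: continuous_omega|exact: continuous_tanh_class].
- by exists M.
Qed.

Lemma jint_sqr_gt0 p : p != 0 -> 0 < jint (p * p).
Proof.
move=> p0; have [x px] : exists x, p.[tanh x] != 0.
  apply/not_existsP => h; move/eqP: p0; apply; apply: horner_tanh_eq0 => x.
  by apply/eqP/negPn/negP; exact: h.
rewrite jintM; have [M M1] := omega_tanh_class_bounded_by (p * p).
have E y : omega y * tanh_class (p * p) y = tanh_class p y * tanh_class p y.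
  by rewrite /tanh_class hornerM; ring.
apply: (@continuous_Rintegral_gt0 _ _ x M).
- by apply: continuousMf; exact: continuous_tanh_class.
- by move=> y; rewrite -expr2 sqr_ge0.
- by move=> y; rewrite -E.
- by rewrite -expr2 exprn_even_gt0 //= mulf_neq0 // gt_eqF // omega_gt0.
Qed.

Lemma bigcup_tanh_itv :
  `]-1, 1[%classic = \bigcup_n `[tanh (- n%:R), tanh n%:R : R]%classic.
Proof.
apply/seteqP; split => x /=; rewrite ?in_itv/=.
  move=> /andP[x1 x2].
  pose y := ln ((1 + x) / (1 - x)) / 2.
  have E : tanh y = x.
    have h : expR y ^+ 2 = (1 + x) / (1 - x).
      rewrite -expRM_natl /y mulrC divfK // lnK // posrE divr_gt0 //; lra.
    have yE : expR y * expR (- y) = 1 by rewrite -expRD subrr expR0.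
    have e0 := expR_gt0 y; have e1 := expR_gt0 (- y).
    have yE2 : expR y = expR y ^+ 2 * expR (- y) by rewrite expr2 -mulrA yE mulr1.
    have E2 : tanh y * (expR y ^+ 2 + 1) = expR y ^+ 2 - 1.
      have : tanh y * (expR y + expR (- y)) = expR y - expR (- y).
        by rewrite /tanh divfK // gt_eqF // expRDN_gt0.
      move/(congr1 (fun z => expR y * z)); rewrite mulrCA mulrDr mulrBr yE -expr2.
      by [].
    have g0 : 0 < 1 - x by lra.
    have : tanh y * ((1 + x) + (1 - x)) = (1 + x) - (1 - x).
      have := congr1 (fun z => z * (1 - x)) E2; rewrite h -mulrA mulrDl mulrBl divfK ?gt_eqF // mul1r.
      by move=> ->.
    move=> h2; lra.
  have := archi_boundP (normr_ge0 y); set n := Num.bound _ => /ltW.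
  rewrite ler_norml => /andP[n1 n2]; exists n => //=.
  by rewrite in_itv/= -E !(ltW_homo tanh_homo).
move=> [n _ /=]; rewrite in_itv/= => /andP[h1 h2].
have := onem_tanh_gt0 n%:R; have := onep_tanh_gt0 (- n%:R).
by move=> h3 h4; apply/andP; split; lra.
Qed.

Lemma powR_2cB1_mul (u c : R) : 0 < u -> u `^ (2 * c - 1) * u = u `^ c * u `^ c.
Proof.
move=> u0; have un : u != 0 by rewrite gt_eqF.
rewrite -powRD ?un ?implybT // -[X in _ * X](powRr1 (ltW u0)) -powRD ?un ?implybT //.
by congr powR; ring.
Qed.

(** The substitution [t = tanh x], whose Jacobian [(1 - t) (1 + t)] raises the
    exponents [2 a - 1] and [2 b - 1] of the weight to those of [omega^2]. *)
Lemma jacobi_norm_jint m :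
  jacobi_norm (2 * a - 1) (2 * b - 1) m =
  jint (jacobi (2 * a - 1) (2 * b - 1) m * jacobi (2 * a - 1) (2 * b - 1) m).
Proof.
rewrite /jacobi_norm; set P := jacobi _ _ _.
pose G (t : R) := (1 - t) `^ (2 * a - 1) * (1 + t) `^ (2 * b - 1) * P.[t] ^+ 2.
(* [H] agrees with [G] inside the interval and is written with exponentials,
   whose continuity is available at each inner point. *)
pose H (t : R) := expR ((2 * a - 1) * ln (1 - t)) * expR ((2 * b - 1) * ln (1 + t)) * P.[t] ^+ 2.
have m1 : measurable_fun setT (fun t : R => 1 - t) by exact: measurable_funB.
have m2 : measurable_fun setT (fun t : R => 1 + t) by exact: measurable_funD.
have mG : measurable_fun setT (EFin \o G).
  apply/measurable_EFinP; apply: measurable_funM.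
    apply: measurable_funM.
      exact: (measurableT_comp (measurable_powR (2 * a - 1)) m1).
    exact: (measurableT_comp (measurable_powR (2 * b - 1)) m2).
  by apply: measurable_funX; exact: continuous_measurable_fun (@continuous_horner _ P).
rewrite /Rintegral /jint -(@integral_itv_bndo_bndc _ _ _ (EFin \o G)); last exact: measurable_funTS.
rewrite -(@integral_itv_obnd_cbnd _ _ _ (EFin \o G)); last exact: measurable_funTS.
congr fine; transitivity (\int[leb]_(x in `](-1)%R, 1%R[) (H x)%:E)%E.
  apply: eq_integral => t; rewrite inE/= in_itv/= => /andP[t1 t2]; congr EFin.
  by rewrite /G /H /powR !gt_eqF //; lra.
rewrite (integral_substitution isder_tanh).
- apply: eq_integral => x _; congr EFin; rewrite /tanh_class hornerM /omega.
  have m0 := onem_tanh_gt0 x; have p0 := onep_tanh_gt0 x.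
  have -> : H (tanh x) = G (tanh x) by rewrite /G /H /powR !gt_eqF.
  rewrite /G; transitivity (((1 - tanh x) `^ (2 * a - 1) * (1 - tanh x)) *
    ((1 + tanh x) `^ (2 * b - 1) * (1 + tanh x)) * P.[tanh x] ^+ 2).
    move: ((1 - tanh x) `^ _) ((1 + tanh x) `^ _) (P.[tanh x]) (1 - tanh x ^+ 2)
      (onem_sqr_tanh x) => u v w t ->.
    by move: (1 - tanh x) (1 + tanh x) => y z; ring.
  rewrite (powR_2cB1_mul a m0) (powR_2cB1_mul b p0).
  by move: ((1 - tanh x) `^ a) ((1 + tanh x) `^ b) (P.[tanh x]) => u v w; ring.
- move=> x; apply: cvgB; first exact: cvg_cst.
  by apply: (@continuous_comp _ _ _ (@tanh R) (fun u => u ^+ 2));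
    [exact: continuous_tanh|exact: exprn_continuous].
- move=> x; by rewrite onem_sqr_tanh mulr_gt0 ?onem_tanh_gt0 ?onep_tanh_gt0.
- exact: itv_open.
- exact: bigcup_tanh_itv.
- move=> t; rewrite /= in_itv/= => /andP[t1 t2].
  have cln (c u : R) (k : R -> R) : 0 < k u -> {for u, continuous k} ->
      {for u, continuous (fun t => expR (c * ln (k t)))}.
    move=> ku ck; apply: (@continuous_comp _ _ _ (fun t => c * ln (k t)) expR); last exact: continuous_expR.
    apply: cvgM; first exact: cvg_cst.
    by apply: (@continuous_comp _ _ _ k (@ln R)) => //; exact: continuous_ln.
  apply: cvgM; first apply: cvgM.
  + apply: (cln _ t (fun t => 1 - t)); first by rewrite subr_gt0.
    by apply: cvgB; [exact: cvg_cst|exact: cvg_id].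
  + apply: (cln _ t (fun t => 1 + t)); first by rewrite -ltrBlDl sub0r.
    by apply: cvgD; [exact: cvg_cst|exact: cvg_id].
  apply: (@continuous_comp _ _ _ (horner P) (fun u => u ^+ 2)); first exact: continuous_horner.
  exact: exprn_continuous.
Qed.

End TanhFunctions.

(** * Jacobi polynomials and their three-term relation *)

Section JacobiPolynomials.
Context {R : realType}.
Variables a b : R.
Hypotheses (a0 : 0 < a) (b0 : 0 < b).
Local Notation P := (jacobi (2 * a - 1) (2 * b - 1)).
Local Notation ell := (jint a b).
Local Notation L := (tanh_deriv a b).

(** [P_m = \sum_k jacobi_coef m k * ((t - 1) / 2)^k] with parameters
    [alpha = 2 a - 1] and [beta = 2 b - 1]. *)
Definition jacobi_coef (m k : nat) : R :=
  pochhammer (m%:R + (2 * a - 1) + (2 * b - 1) + 1) k *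
  pochhammer ((2 * a - 1) + k%:R + 1) (m - k) / (k`!%:R * (m - k)`!%:R).

Definition jacobi_shifted (m : nat) : {poly R} := \poly_(k < m.+1) jacobi_coef m k.

Definition half_shift : {poly R} := 2^-1 *: ('X - 1).

Lemma jacobiE m : P m = jacobi_shifted m \Po half_shift.
Proof.
rewrite /jacobi_shifted poly_def raddf_sum /=; apply: eq_bigr => k _.
by rewrite comp_polyZ rmorphXn /= comp_polyX.
Qed.

Lemma jacobi_coef_rec m k : (k < m)%N ->
  k.+1%:R * (k%:R + 2 * a) * jacobi_coef m k.+1 =
  (m%:R - k%:R) * (m%:R + k%:R + (2 * a + 2 * b - 1)) * jacobi_coef m k.
Proof.
move=> km; rewrite /jacobi_coef.
have -> : (m - k = (m - k.+1).+1)%N by rewrite subnSK.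
set n := (m - k.+1)%N; have -> : m%:R = n%:R + k%:R + 1 :> R.
  by rewrite /n -natrD natr1; congr _%:R; lia.
rewrite {1}/pochhammer big_ord_recr /= -/(pochhammer _ k).
rewrite [X in _ = _ * (_ * X / _)]/pochhammer big_ord_recl /= addr0.
have -> : \prod_(i < n) (2 * a - 1 + k%:R + 1 + (lift ord0 i)%:R) =
    pochhammer (2 * a - 1 + k.+1%:R + 1) n.
  by apply: eq_bigr => i _; rewrite lift0 -!natr1; ring.
rewrite !factS !natrM; move: (pochhammer _ k) (pochhammer _ n) => u v.
have h1 : k`!%:R != 0 :> R by rewrite pnatr_eq0 -lt0n fact_gt0.
have h2 : n`!%:R != 0 :> R by rewrite pnatr_eq0 -lt0n fact_gt0.
rewrite -!natr1; field.
by rewrite h1 h2 /= !natr1 !pnatr_eq0.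
Qed.

(** The hypergeometric equation: coefficientwise it is the two-term recurrence
    [jacobi_coef_rec]. *)
Lemma jacobi_shifted_ode m :
  ('X^2 + 'X) * (jacobi_shifted m)^`()^`() +
  ((2 * a)%:P + (2 * a + 2 * b) *: 'X) * (jacobi_shifted m)^`() =
  (m%:R * (m%:R + (2 * a + 2 * b - 1))) *: jacobi_shifted m.
Proof.
set p := jacobi_shifted m.
have pE k : p`_k = if (k < m.+1)%N then jacobi_coef m k else 0 by rewrite coef_poly.
have crec k : k.+1%:R * (k%:R + 2 * a) * p`_k.+1 =
    (m%:R - k%:R) * (m%:R + k%:R + (2 * a + 2 * b - 1)) * p`_k.
  rewrite !pE ltnS; case: (ltngtP k m) => km; rewrite ?ltnS ?(ltnW km) ?leqnn //.
  - exact: jacobi_coef_rec.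
  - by rewrite leqNgt km !mulr0.
  - by rewrite km subrr !mulr0 !mul0r.
have dE (q : {poly R}) k : q^`()`_k = k.+1%:R * q`_k.+1 by rewrite coef_deriv mulr_natl.
apply/polyP => k; rewrite (mulrDl 'X^2) (mulrDl (2 * a)%:P) !coefD coefZ -scalerAl.
rewrite coefZ coefCM coefXnM !coefXM.
have := crec k; case: k => [|[|k]] /=; rewrite !dE.
- move: (p`_1) (p`_0) => u v E.
  transitivity (1 * (0 + 2 * a) * u); first by ring.
  by rewrite E; ring.
- move: (p`_2) (p`_1) => u v E.
  transitivity (2 * (1 + 2 * a) * u + (2 * a + 2 * b) * v); first by ring.
  by rewrite E; ring.
rewrite subn2 /= -![k.+3%:R]natr1 -![k.+2%:R]natr1 -![k.+1%:R]natr1.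
move: (p`_k.+3) (p`_k.+2) (k%:R) => u v c E.
transitivity ((c + 1 + 1 + 1) * (c + 1 + 1 + 2 * a) * u +
   ((c + 1) * (c + 1 + 1) + (2 * a + 2 * b) * (c + 1 + 1)) * v); first by ring.
by rewrite E; ring.
Qed.

Lemma jacobi_ode m :
  (1 - 'X^2) * (P m)^`()^`() + 2 *: (((b - a)%:P - (a + b) *: 'X) * (P m)^`()) =
  - (m%:R * (m%:R + (2 * a + 2 * b - 1))) *: P m.
Proof.
rewrite jacobiE scaleNr -comp_polyZ -jacobi_shifted_ode.
set p := jacobi_shifted m.
have dY : half_shift^`() = (2^-1)%:P.
  by rewrite /half_shift derivZ derivB derivX derivC subr0 alg_polyC.
have X2Y : 'X = 2 *: half_shift + 1 :> {poly R}.
  by rewrite /half_shift scalerA divff ?scale1r ?subrK.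
rewrite !deriv_comp dY !derivM derivC mulr0 addr0 deriv_comp dY.
rewrite !(rmorphD, rmorphM) /= !comp_polyC comp_polyZ !comp_polyX.
move: (p^`()^`() \Po _) (p^`() \Po _) => u v.
rewrite [in LHS]X2Y; move: half_shift => Y.
rewrite -!mul_polyC !(polyCD, polyCN, polyCM, polyCB) !polyC1.
have h2 : (2%:P * (2^-1)%:P = 1 :> {poly R}) by rewrite -polyCM divff.
have E2 : 2%:P = 1 + 1 :> {poly R} by rewrite -polyC1 -polyCD.
move: h2; rewrite E2; move: (a%:P) (b%:P) ((2^-1)%:P : {poly R}) => A B H h2.
have uE : u = (1 + 1) * (1 + 1) * (u * H * H).
  transitivity (u * ((1 + 1) * H) * ((1 + 1) * H)); last by ring.
  by rewrite h2 !mulr1.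
have vE : v = (1 + 1) * (v * H).
  transitivity (v * ((1 + 1) * H)); last by ring.
  by rewrite h2 !mulr1.
rewrite [in RHS]uE [in RHS]vE; move: (u * H * H) (v * H) => u' v'.
by ring.
Qed.

(** Skewness of [L] for the pair [p'], [q]: the differential operator on the
    left is, up to the weight, the derivative of [(1 - t^2)] times the weight
    times [p']. *)
Lemma jint_sturm_liouville p q :
  ell (((1 - 'X^2) * p^`()^`() + 2 *: (((b - a)%:P - (a + b) *: 'X) * p^`())) * q) =
  - ell ((1 - 'X^2) * (p^`() * q^`())).
Proof.
have := jint_skew a0 b0 p^`() q => E.
have E' : ell (L p^`() * q + p^`() * L q) = 0 by rewrite jintD // E addNr.
apply/eqP; rewrite -addr_eq0 -jintD // -E'; apply/eqP; congr jint.
rewrite /tanh_deriv -!mul_polyC.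
have -> : 2%:P = 1 + 1 :> {poly R} by rewrite -polyC1 -polyCD.
by move: (p^`()^`()) (p^`()) (q^`()) ((b - a)%:P) ((a + b)%:P) => u v w A B; ring.
Qed.

(** The right-hand side of [jint_sturm_liouville] is symmetric in [p] and [q], so
    two Jacobi polynomials with distinct eigenvalues
    [m (m + 2 a + 2 b - 1)] are orthogonal.  The eigenvalues are distinct because
    [m + n + 2 a + 2 b - 1 > 0] as soon as [m + n >= 1]. *)
Lemma jacobi_orthogonal m n : m != n -> ell (P m * P n) = 0.
Proof.
have sym k l : k%:R * (k%:R + (2 * a + 2 * b - 1)) * ell (P k * P l) =
    ell ((1 - 'X^2) * ((P k)^`() * (P l)^`())).
  have := jint_sturm_liouville (P k) (P l); rewrite jacobi_ode -scalerAl jintZ //.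
  by rewrite mulNr => /oppr_inj.
move=> mn; have := sym m n; have := sym n m.
rewrite (mulrC (P n)) (mulrC (P n)^`()) => <- /eqP.
rewrite -subr_eq0 -mulrBl mulf_eq0 => /orP[|/eqP //].
have -> : m%:R * (m%:R + (2 * a + 2 * b - 1)) - n%:R * (n%:R + (2 * a + 2 * b - 1)) =
  (m%:R - n%:R) * (m%:R + n%:R + (2 * a + 2 * b - 1)) by ring.
rewrite mulf_eq0 subr_eq0 eqr_nat (negbTE mn) /= => /eqP h; exfalso.
have : 1 <= m%:R + n%:R :> R.
  by rewrite -natrD ler1n; case: m n mn {sym h} => [|m] [|n].
move: (m%:R) (n%:R) h => u v h1 h2; have := a0; have := b0; lra.
Qed.

Lemma jacobi_coef_gt0 m : 0 < jacobi_coef m m.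
Proof.
rewrite /jacobi_coef subnn /pochhammer big_ord0 mulr1.
rewrite divr_gt0 ?mulr_gt0 ?ltr0n ?fact_gt0 //.
apply: prodr_gt0 => i _; have : 1 <= m%:R :> R by rewrite ler1n (leq_ltn_trans _ (ltn_ord i)).
have : 0 <= i%:R :> R by [].
by move: (m%:R) (i%:R) => u v; have := a0; have := b0; lra.
Qed.

Lemma size_half_shift : size half_shift = 2.
Proof. by rewrite size_scale ?size_XsubC // invr_eq0. Qed.

Lemma size_jacobi m : size (P m) = m.+1.
Proof.
rewrite jacobiE size_comp_poly2 ?size_half_shift // size_poly_eq //.
by rewrite gt_eqF // jacobi_coef_gt0.
Qed.

Lemma lead_coef_jacobi_gt0 m : 0 < lead_coef (P m).
Proof.
rewrite jacobiE lead_coef_comp ?size_half_shift //.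
rewrite lead_coef_poly // ?gt_eqF ?jacobi_coef_gt0 // mulr_gt0 ?jacobi_coef_gt0 //.
by rewrite exprn_gt0 // /half_shift lead_coefZ lead_coefXsubC mulr1.
Qed.

Definition jacobi_on (m : nat) : {poly R} :=
  ((-1) ^+ m / Num.sqrt (ell (P m * P m))) *: P m.

Local Notation q := jacobi_on.

Lemma jint_jacobi_gt0 m : 0 < ell (P m * P m).
Proof. by apply: jint_sqr_gt0 => //; rewrite -size_poly_eq0 size_jacobi. Qed.

Lemma jacobi_on_orthonormal m n : ell (q m * q n) = (m == n)%:R.
Proof.
rewrite /q -scalerAl -scalerAr !jintZ //.
have [<-|mn] := eqVneq m n; last by rewrite (jacobi_orthogonal mn) !mulr0.
have g0 := jint_jacobi_gt0 m.
have s0 : Num.sqrt (ell (P m * P m)) != 0 by rewrite gt_eqF // sqrtr_gt0.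
have e2 : (-1) ^+ m * (-1) ^+ m = 1 :> R by rewrite -expr2 sqrr_sign.
rewrite -{3}(sqr_sqrtr (ltW g0)); move: (Num.sqrt _) ((-1) ^+ m) s0 e2 => s e s0 e2.
by transitivity (e * e); [field|exact: e2].
Qed.

Let scale_neq0 m : (-1) ^+ m / Num.sqrt (ell (P m * P m)) != 0.
Proof. by rewrite mulf_neq0 ?signr_eq0 // invr_eq0 gt_eqF // sqrtr_gt0 jint_jacobi_gt0. Qed.

Lemma size_jacobi_on m : size (q m) = m.+1.
Proof. by rewrite size_scale ?size_jacobi. Qed.

Lemma lead_coef_jacobi_on_sign m : 0 < (-1) ^+ m * lead_coef (q m).
Proof.
rewrite lead_coefZ !mulrA.
have -> : (-1) ^+ m * (-1) ^+ m = 1 :> R by rewrite -expr2 sqrr_sign.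
rewrite mul1r.
rewrite mulr_gt0 ?lead_coef_jacobi_gt0 //.
by rewrite invr_gt0 sqrtr_gt0 jint_jacobi_gt0.
Qed.

Lemma jacobi_on_coef_neq0 m : (q m)`_m != 0.
Proof.
have := lead_coef_jacobi_on_sign m; rewrite /lead_coef size_jacobi_on /= => h.
by apply: contraTneq h => ->; rewrite mulr0 ltxx.
Qed.

Lemma jint0 : ell 0 = 0. Proof. by rewrite -(scale0r 0) jintZ // mul0r. Qed.

Lemma jintN p : ell (- p) = - ell p.
Proof. by rewrite -scaleN1r jintZ // mulN1r. Qed.

(** The [q k] with [k < n] span the polynomials of degree less than [n], since
    [q k] has degree [k]. *)
Lemma jint_orthogonal_span (r : {poly R}) n : (forall k, (k < n)%N -> ell (r * q k) = 0) ->
  forall s : {poly R}, (size s <= n)%N -> ell (r * s) = 0.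
Proof.
elim: n => [|n IH] rq s sn.
  by move: sn; rewrite leqn0 size_poly_eq0 => /eqP ->; rewrite mulr0 jint0.
pose c := s`_n / (q n)`_n.
have -> : s = c *: q n + (s - c *: q n) by rewrite addrC subrK.
rewrite mulrDr jintD // -scalerAr jintZ // rq // mulr0 add0r.
apply: IH => [k kn|]; first by apply: rq; exact: leqW.
apply/leq_sizeP => i; rewrite leq_eqVlt => /orP[/eqP <-|ni].
  by rewrite coefB coefZ /c divfK ?subrr // jacobi_on_coef_neq0.
rewrite coefB coefZ [s`_i]nth_default; last exact: leq_trans sn ni.
by rewrite nth_default ?mulr0 ?subr0 // size_jacobi_on.
Qed.

Lemma jacobi_on_lower m (s : {poly R}) : (size s <= m)%N -> ell (q m * s) = 0.
Proof.
apply: jint_orthogonal_span => k km; rewrite jacobi_on_orthonormal.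
by rewrite gtn_eqF.
Qed.

Lemma jint_orthogonal_eq0 (r : {poly R}) n : (size r <= n)%N ->
  (forall k, (k < n)%N -> ell (r * q k) = 0) -> r = 0.
Proof.
move=> rn rq; apply/eqP/negPn/negP => r0.
by have := jint_sqr_gt0 a0 b0 r0; rewrite (jint_orthogonal_span rq rn) ltxx.
Qed.

Lemma size_tanh_deriv_le (s : {poly R}) n : (size s <= n)%N -> (size (L s) <= n.+1)%N.
Proof.
move=> sn; have [->|s0] := eqVneq s 0.
  by rewrite /tanh_deriv deriv0 !mulr0 addr0 size_poly0.
rewrite /tanh_deriv (leq_trans (size_polyD _ _)) // geq_max; apply/andP; split.
  apply: (leq_trans (size_polyMleq _ _)).
  have h1 : (size (1 - 'X^2 : {poly R})%R <= 3)%N.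
    rewrite (leq_trans (size_polyD _ _)) // size_polyN size_polyXn size_poly1 //.
  have h2 := lt_size_deriv s0; lia.
apply: (leq_trans (size_polyMleq _ _)).
have h1 : (size ((b - a)%:P - (a + b) *: 'X : {poly R})%R <= 2)%N.
  rewrite (leq_trans (size_polyD _ _)) // size_polyN geq_max.
  rewrite (leq_trans (size_polyC_leq1 _)) //=.
  by rewrite (leq_trans (size_scale_leq _ _)) // size_polyX.
by lia.
Qed.

(** The leading coefficient changes sign under [L]; this is why the factor
    [(-1) ^+ m] in [jacobi_on] makes the coefficients [jacobi_b] positive. *)
Lemma coef_tanh_deriv_top (s : {poly R}) n : (size s <= n.+1)%N ->
  (L s)`_n.+1 = - (n%:R + (a + b)) * s`_n.
Proof.
move=> sn; rewrite /tanh_deriv !mulrBl mul1r coefD !coefB coefCM coefXnM.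
rewrite -scalerAl coefZ coefXM /= !coef_deriv.
rewrite [s`_n.+2]nth_default ?(leq_trans sn) // [s`_n.+1]nth_default //.
case: n sn => [|n] sn /=; first by rewrite mul0rn mulr0 !sub0r; ring.
rewrite mul0rn mulr0 !sub0r subn2 /= -mulr_natl -natr1.
by ring.
Qed.

(** The leading coefficient of [L (q m)] divided by that of [q m.+1]. *)
Definition jacobi_b (m : nat) : R := - (m%:R + (a + b)) * (q m)`_m / (q m.+1)`_m.+1.

Lemma jacobi_b_gt0 m : 0 < jacobi_b m.
Proof.
have h1 := lead_coef_jacobi_on_sign m; have h2 := lead_coef_jacobi_on_sign m.+1.
move: h1 h2; rewrite /lead_coef !size_jacobi_on /= exprS => h1 h2.
have -> : jacobi_b m = (m%:R + (a + b)) * ((-1) ^+ m * (q m)`_m) /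
    (-1 * (-1) ^+ m * (q m.+1)`_m.+1).
  rewrite /jacobi_b; field.
  by rewrite signr_eq0 jacobi_on_coef_neq0.
by rewrite divr_gt0 // mulr_gt0 // ltr_wpDl // addr_gt0.
Qed.

Lemma size_three_term m : (size (L (q m) - jacobi_b m *: q m.+1)%R <= m.+1)%N.
Proof.
apply/leq_sizeP => i; rewrite leq_eqVlt => /orP[/eqP <-|mi].
  rewrite coefB coefZ coef_tanh_deriv_top ?size_jacobi_on // /jacobi_b.
  by rewrite divfK ?subrr // jacobi_on_coef_neq0.
rewrite coefB coefZ nth_default; last first.
  by rewrite (leq_trans (size_tanh_deriv_le (n := m.+1) _)) ?size_jacobi_on.
by rewrite nth_default ?mulr0 ?subr0 // size_jacobi_on.
Qed.

Lemma jint_tanh_deriv_jacobi_on m : ell (q m.+1 * L (q m)) = jacobi_b m.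
Proof.
have -> : L (q m) = jacobi_b m *: q m.+1 + (L (q m) - jacobi_b m *: q m.+1).
  by rewrite addrC subrK.
rewrite mulrDr jintD // -scalerAr jintZ // jacobi_on_orthonormal eqxx mulr1.
by rewrite jacobi_on_lower ?addr0 // size_three_term.
Qed.

Lemma jint_skew_diag s : ell (L s * s) = 0.
Proof.
have := jint_skew a0 b0 s s; rewrite [s * _]mulrC => /eqP.
by rewrite -addr_eq0 -mulr2n mulrn_eq0 /= => /eqP.
Qed.

Lemma tanh_deriv_jacobi0 : L (q 0) = jacobi_b 0 *: q 1.
Proof.
apply/eqP; rewrite -subr_eq0; apply/eqP; apply: (@jint_orthogonal_eq0 _ 1).
  exact: size_three_term.
case=> // _; rewrite mulrBl jintD // jintN -scalerAl jintZ // jacobi_on_orthonormal.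
by rewrite mulr0 subr0 jint_skew_diag.
Qed.

(** The difference of the two sides has degree at most [m + 1], and it is
    orthogonal to each [q k] with [k <= m + 1]: for [k = m + 1] because [L] is
    skew, for [k = m] by skewness and the definition of [jacobi_b m], and for
    [k < m] because [L (q k)] has degree at most [m]. *)
Lemma tanh_deriv_jacobiS m :
  L (q m.+1) = jacobi_b m.+1 *: q m.+2 - jacobi_b m *: q m.
Proof.
apply/eqP; rewrite -subr_eq0 opprB addrCA addrC; apply/eqP.
apply: (@jint_orthogonal_eq0 _ m.+2).
  rewrite (leq_trans (size_polyD _ _)) // geq_max size_three_term /=.
  rewrite (leq_trans (size_scale_leq _ _)) // size_jacobi_on; lia.
move=> k km; rewrite mulrDl mulrBl !jintD // jintN.
rewrite -(scalerAl (jacobi_b m.+1)) -(scalerAl (jacobi_b m)) !jintZ //.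
rewrite !jacobi_on_orthonormal (gtn_eqF km) mulr0 subr0.
move: km; rewrite !ltnS leq_eqVlt => /orP[/eqP ->|].
  by rewrite jint_skew_diag ltn_eqF ?mulr0 ?addr0.
rewrite ltnS leq_eqVlt => /orP[/eqP ->|km].
  by rewrite eqxx mulr1 jint_skew // jint_tanh_deriv_jacobi_on addNr.
rewrite gtn_eqF // mulr0 addr0 jint_skew // jacobi_on_lower ?oppr0 //.
by rewrite (leq_trans (size_tanh_deriv_le (n := k.+1) _)) ?size_jacobi_on.
Qed.

(** The pair carries [p_m] and [p_(m-1)].  In the first step the index [0.-1] is
    harmless, since [p_(-1) = 0]. *)
Fixpoint fourier_pair (m : nat) : {poly R} * {poly R} :=
  if m is m'.+1 then
    let: (p, p') := fourier_pair m' in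
    ((jacobi_b m')^-1 *: ('X * p - jacobi_b m'.-1 *: p'), p)
  else (1, 0).

Definition fourier_poly m := (fourier_pair m).1.

Lemma fourier_poly0 : fourier_poly 0 = 1. Proof. by []. Qed.

Lemma fourier_poly1 : jacobi_b 0 *: fourier_poly 1 = 'X.
Proof.
rewrite /fourier_poly /= mulr1 scaler0 subr0 scalerA divff ?scale1r //.
by rewrite gt_eqF // jacobi_b_gt0.
Qed.

Lemma fourier_polySS m : jacobi_b m.+1 *: fourier_poly m.+2 =
  'X * fourier_poly m.+1 - jacobi_b m *: fourier_poly m.
Proof.
rewrite /fourier_poly /=; case: (fourier_pair m) => p p' /=.
by rewrite scalerA divff ?scale1r // gt_eqF // jacobi_b_gt0.
Qed.

Lemma fourier_poly_size_lead m :
  size (fourier_poly m) = m.+1 /\ 0 < lead_coef (fourier_poly m).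
Proof.
suff: (size (fourier_poly m) = m.+1 /\ 0 < lead_coef (fourier_poly m)) /\
      (size (fourier_poly m.+1) = m.+2 /\ 0 < lead_coef (fourier_poly m.+1)) by case.
have bn0 n : jacobi_b n != 0 by rewrite gt_eqF // jacobi_b_gt0.
elim: m => [|m [[s0 l0] [s1 l1]]].
  split; first by rewrite fourier_poly0 size_poly1 lead_coef1.
  have := fourier_poly1 => E; split.
    by rewrite -(size_scale _ (bn0 0%N)) E size_polyX.
  by have := lead_coefX R; rewrite -E lead_coefZ => h; rewrite -(pmulr_rgt0 _ (jacobi_b_gt0 0)) h.
split => //; have E := fourier_polySS m.
have n1 : fourier_poly m.+1 != 0 by rewrite -size_poly_eq0 s1.
have lt : (size (- (jacobi_b m *: fourier_poly m))%R < size ('X * fourier_poly m.+1)%R)%N.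
  by rewrite size_polyN (size_scale _ (bn0 m)) s0 mulrC size_mulX // s1.
split.
  by rewrite -(size_scale _ (bn0 m.+1)) E size_polyDl // mulrC size_mulX // s1.
rewrite -(pmulr_rgt0 _ (jacobi_b_gt0 m.+1)) -lead_coefZ E lead_coefDl //.
by rewrite lead_coefM lead_coefX mul1r.
Qed.

End JacobiPolynomials.

(** * The product of two Gamma functions as a Fourier transform *)

Section GammaProduct.
Context {R : realType}.
Local Notation leb := (@lebesgue_measure R).
Local Open Scope complex_scope.

(** The integrand of Euler's integral for [Gamma a] after [t = exp (2 u)], apart
    from the factor 2. *)
Definition egamma (a u : R) : R := expR (2 * a * u - expR (2 * u)).

Lemma egamma_gt0 a u : 0 < egamma a u. Proof. exact: expR_gt0. Qed.

Lemma continuous_expR_scale (c : R) : continuous (fun u : R => expR (c * u)).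
Proof.
move=> x; apply: (@continuous_comp _ _ _ (fun u : R => c * u) expR).
  exact: continuous_scale.
exact: continuous_expR.
Qed.

Lemma continuous_egamma a : continuous (egamma a).
Proof.
move=> x; apply: (@continuous_comp _ _ _ (fun u : R => 2 * a * u - expR (2 * u)) expR).
  by apply: cvgB; [exact: continuous_scale|exact: continuous_expR_scale].
exact: continuous_expR.
Qed.

(** As [u] grows, [exp (2 u) >= (1 + u)^2] beats the linear exponent; as [u]
    decreases, [exp (2 a u)] itself decays.  The square of [oneDsqr] is needed in
    [egamma_prod_bounded_by], where one factor is spent on moving the decay of
    [egamma b (x + u)] from [x + u] to [x]. *)
Lemma egamma_bounded_by2 a : 0 < a ->
  exists2 M : R, 0 <= M & forall u, egamma a u <= M / oneDsqr u / oneDsqr u.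
Proof.
move=> a0; pose M := expR (2 * a ^+ 2) * (1 + 4 / a ^+ 2).
have M0 : 0 <= M by rewrite mulr_ge0 ?expR_ge0 // addr_ge0 // divr_ge0 // sqr_ge0.
have h u : expR (a * u - expR (2 * u) / 2) <= M / oneDsqr u.
  apply: (@le_trans _ _ (expR (2 * a ^+ 2) * expR (- (a * `|u|)))); last first.
    by rewrite /M -mulrA ler_wpM2l ?expR_ge0 // expRN_bound.
  rewrite -expRD ler_expR.
  case: (lerP 0 u) => u0; [rewrite ger0_norm //|rewrite ltr0_norm //].
    have e1 := expR_ge1Dx u.
    have e2 : (1 + u) * (1 + u) <= expR (2 * u).
      have -> : 2 * u = u + u by ring.
      by rewrite expRD ler_pM // addr_ge0.
    have := sqr_ge0 (u - 2 * a) => e3; nra.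
  have := expR_gt0 (2 * u); have := sqr_ge0 a; nra.
exists (M * M); first exact: mulr_ge0.
move=> u; rewrite -mulrA -invfM -[X in _ / X]/(oneDsqr u * oneDsqr u) invfM mulrACA.
have -> : egamma a u = expR (a * u - expR (2 * u) / 2) * expR (a * u - expR (2 * u) / 2).
  by rewrite -expRD; congr expR; field.
by rewrite ler_pM ?expR_ge0.
Qed.

Lemma egamma_bounded_by a : 0 < a ->
  exists M : R, forall u, `|egamma a u| <= M / oneDsqr u.
Proof.
move=> /egamma_bounded_by2[M M0 aM]; exists M => u.
rewrite gtr0_norm ?egamma_gt0 // (le_trans (aM u)) // ler_piMr ?oneDsqrV_le1 //.
by rewrite divr_ge0 // ltW // oneDsqr_gt0.
Qed.

Lemma bigcup_expR_itv :
  `]0, +oo[%classic = \bigcup_n `[expR (2 * - n%:R), expR (2 * n%:R) : R]%classic.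
Proof.
apply/seteqP; split => x /=; rewrite ?in_itv/= ?andbT.
  move=> x0; have := archi_boundP (normr_ge0 (ln x / 2)); set n := Num.bound _ => /ltW.
  rewrite ler_norml => /andP[n1 n2]; exists n => //=.
  rewrite in_itv/= -{1 2}(lnK x0 : expR (ln x) = x) !ler_expR.
  by apply/andP; split; lra.
by move=> [n _ /=]; rewrite in_itv/= => /andP[h _]; rewrite (lt_le_trans _ h) ?expR_gt0.
Qed.

Lemma mellin_substitution (a : R) (k : R -> R) : continuous k ->
  (\int[leb]_(t in `]0%R, +oo[) (t `^ (a - 1) * k (ln t) * expR (- t))%:E =
  \int[leb]_u (2 * (egamma a u * k (2 * u)))%:E)%E.
Proof.
move=> ck.
pose H (t : R) := expR ((a - 1) * ln t) * k (ln t) * expR (- t).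
transitivity (\int[leb]_(t in `]0%R, +oo[) (H t)%:E)%E.
  apply: eq_integral => t; rewrite inE/= in_itv/= andbT => t0; congr EFin.
  by rewrite /H /powR gt_eqF.
have dF (x : R) : is_derive x 1 (fun u : R => expR (2 * u)) (2 * expR (2 * x)).
  apply: isder_eq (@isder_comp R expR (fun u => 2 * u) x _ _ (isder_scale 2 x) (is_derive_expR _)) _.
  by rewrite mulrC.
rewrite (integral_substitution dF).
- apply: eq_integral => u _; congr EFin; rewrite /H expRK /egamma.
  have -> : expR (2 * a * u - expR (2 * u)) =
      expR ((a - 1) * (2 * u)) * expR (2 * u) * expR (- expR (2 * u)).
    by rewrite -!expRD; congr expR; ring.
  by ring.
- by apply: continuousMf; [exact: cst_continuous|exact: continuous_expR_scale].
- by move=> x; rewrite mulr_gt0 // expR_gt0.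
- by rewrite set_itvoy; exact: open_gt.
- exact: bigcup_expR_itv.
- move=> t; rewrite /= in_itv/= andbT => t0; have cl := continuous_ln t0.
  apply: cvgM; first apply: cvgM.
  + apply: (@continuous_comp _ _ _ (fun t => (a - 1) * ln t) expR); last exact: continuous_expR.
    by apply: cvgM; [exact: cvg_cst|exact: cl].
  + by apply: (@continuous_comp _ _ _ (@ln R) k) => //; exact: ck.
  apply: (@continuous_comp _ _ _ (fun t : R => - t) expR); last exact: continuous_expR.
  exact: continuousN.
Qed.

(** The scale [t = exp (2 u)] is chosen so that [t^(i xi / 2)] becomes
    [exp (i xi u)]. *)
Lemma cGammaE (a xi : R) : 0 < a ->
  cGamma (a +i* (xi / 2)) = (2 * cosT (egamma a) xi) +i* (2 * sinT (egamma a) xi).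
Proof.
move=> a0; have [M aM] := egamma_bounded_by a0; have ca := @continuous_egamma a.
have chalf (k : R -> R) : continuous k -> continuous (fun t : R => k (xi / 2 * t)).
  move=> ck x; apply: (@continuous_comp _ _ _ (fun u : R => xi / 2 * u) k).
    exact: continuous_scale.
  exact: ck.
have half (u : R) : xi / 2 * (2 * u) = xi * u by field.
rewrite /cGamma /cintegral; congr (_ +i* _).
- rewrite /cosT -RintegralZl //; last exact: (integrable_cos ca aM xi).
  rewrite /Rintegral; congr fine.
  transitivity (\int[leb]_(t in `]0%R, +oo[) (t `^ (a - 1) * cos (xi / 2 * ln t) * expR (- t))%:E)%E.
    apply: eq_integral => t _; congr EFin.
    by rewrite /cpower /cis /= !subr0 !mul0r !mulr0 ?subr0 ?addr0.
  rewrite (mellin_substitution a (chalf _ (@continuous_cos R))).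
  by apply: eq_integral => u _; rewrite half.
- rewrite /sinT -RintegralZl //; last exact: (integrable_sin ca aM xi).
  rewrite /Rintegral; congr fine.
  transitivity (\int[leb]_(t in `]0%R, +oo[) (t `^ (a - 1) * sin (xi / 2 * ln t) * expR (- t))%:E)%E.
    apply: eq_integral => t _; congr EFin.
    by rewrite /cpower /cis /= !subr0 !mul0r !mulr0 ?subr0 ?addr0 ?add0r.
  rewrite (mellin_substitution a (chalf _ (@continuous_sin R))).
  by apply: eq_integral => u _; rewrite half.
Qed.

(** Peetre's inequality: a shift by [u] changes [1 + x^2] by at most a factor
    comparable to [1 + u^2]. *)
Lemma oneDsqr_peetre (u x : R) : oneDsqr x <= 2 * oneDsqr u * oneDsqr (x + u).
Proof.
rewrite /oneDsqr -subr_ge0.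
have -> : 2 * (1 + u ^+ 2) * (1 + (x + u) ^+ 2) - (1 + x ^+ 2) =
  1 + (x + 2 * u) ^+ 2 + 2 * (u * (x + u)) ^+ 2 by ring.
by rewrite !addr_ge0 ?sqr_ge0 // mulr_ge0 // sqr_ge0.
Qed.

Section Product.
Variables a b : R.
Hypotheses (a0 : 0 < a) (b0 : 0 < b).

Definition ecorr (x : R) : R := \int[leb]_u (egamma a u * egamma b (x + u)).

Lemma egamma_prod_bounded_by : exists M : R, forall u x,
  `|egamma a u * egamma b (x + u)| <= M / oneDsqr u / oneDsqr x.
Proof.
have [M M0 aM] := egamma_bounded_by2 a0; have [N bN] := egamma_bounded_by b0.
have N0 := bounded_by_ge0 bN.
exists (M * (N * 2)) => u x; rewrite normrM gtr0_norm ?egamma_gt0 //.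
have p1 := oneDsqr_gt0 u; have p2 := oneDsqr_gt0 x; have p3 := oneDsqr_gt0 (x + u).
apply: (@le_trans _ _ (M / oneDsqr u / oneDsqr u * (N / oneDsqr (x + u)))).
  by apply: ler_pM => //; rewrite ?egamma_gt0 // ltW // egamma_gt0.
have -> : M / oneDsqr u / oneDsqr u * (N / oneDsqr (x + u)) =
  (M * N / oneDsqr u) / (oneDsqr u * oneDsqr (x + u)) by field; rewrite !gt_eqF.
have -> : M * (N * 2) / oneDsqr u / oneDsqr x = (M * N / oneDsqr u) * (2 / oneDsqr x).
  by field; rewrite !gt_eqF.
apply: ler_wpM2l; first by rewrite divr_ge0 ?mulr_ge0 // ltW.
rewrite ler_pdivlMr // mulrC ler_pdivrMr ?mulr_gt0 //.
by rewrite mulrA oneDsqr_peetre.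
Qed.

(** After the translation [v = x + u] this is an exchange of the integrals in [u]
    and [x].  It is used for the kernels [cos (xi x)] and [sin (xi x)]. *)
Lemma correlation_exchange (k : R -> R) : continuous k -> (forall x, `|k x| <= 1) ->
  \int[leb]_u (egamma a u * \int[leb]_v (egamma b v * k (v - u))) =
  \int[leb]_x (ecorr x * k x).
Proof.
move=> ck k1; have [N bN] := egamma_bounded_by b0.
have [M abM] := egamma_prod_bounded_by.
have ca := @continuous_egamma a; have cb := @continuous_egamma b.
have mx (u : R) : measurable_fun setT (fun x : R => egamma b (x + u)).
  apply: measurableT_comp; first exact: continuous_measurable_fun.
  exact: measurable_funD.
pose F (z : R * R) := egamma a z.1 * egamma b (z.2 + z.1) * k z.2.
have FM u x : `|F (u, x)| <= M / oneDsqr u / oneDsqr x.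
  by rewrite /F /= normrM -[leRHS]mulr1 ler_pM.
transitivity (\int[leb]_u \int[leb]_x F (u, x)).
  apply: eq_Rintegral => u _.
  have -> : \int[leb]_v (egamma b v * k (v - u)) = \int[leb]_x (egamma b (x + u) * k x).
    rewrite -(@Rintegral_translation _ (fun v => egamma b v * k (v - u)) u).
      by apply: eq_Rintegral => x _; rewrite addrK.
    apply: continuousMf => // x; apply: (@continuous_comp _ _ _ (fun v : R => v - u) k).
      by apply: cvgB; [exact: cvg_id|exact: cvg_cst].
    exact: ck.
  rewrite -RintegralZl //; first by apply: eq_Rintegral => x _; rewrite /F mulrA.
  apply: (@integrable_bounded_by _ (2 * N * oneDsqr u)).
    by apply: measurable_funM => //; exact: continuous_measurable_fun.
  move=> x; rewrite normrM -[leRHS]mulr1 ler_pM // (le_trans (bN _)) //.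
  rewrite ler_pdivlMr ?oneDsqr_gt0 // mulrAC ler_pdivrMr ?oneDsqr_gt0 //.
  have := ler_wpM2l (bounded_by_ge0 bN) (oneDsqr_peetre u x).
  by congr (_ <= _); ring.
rewrite (@Fubini_bounded_by _ _ M) //.
  apply: eq_Rintegral => x _; rewrite /ecorr /F /= -RintegralZr //.
  apply: (@integrable_bounded_by _ (M / oneDsqr x)).
    apply: measurable_funM; first exact: continuous_measurable_fun.
    apply: measurableT_comp; first exact: continuous_measurable_fun.
    exact: measurable_funD.
  by move=> u; rewrite mulrAC.
apply: measurable_funM; first apply: measurable_funM.
- by apply: measurableT_comp => //; exact: continuous_measurable_fun.
- apply: measurableT_comp; first exact: continuous_measurable_fun.
  exact: measurable_funD.
- by apply: measurableT_comp => //; exact: continuous_measurable_fun.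
Qed.

(** The correlation theorem and the addition formulas: the transform of a
    correlation is the product of one transform and the conjugate of the
    other. *)
Lemma cGamma_prod (xi : R) :
  cGamma (a +i* (xi / 2)) * cGamma (b -i* (xi / 2)) =
  (4 * cosT ecorr xi) -i* (4 * sinT ecorr xi).
Proof.
have [M aM] := egamma_bounded_by a0; have [N bN] := egamma_bounded_by b0.
have ca := @continuous_egamma a; have cb := @continuous_egamma b.
have -> : b -i* (xi / 2) = b +i* (- xi / 2) by rewrite mulNr.
rewrite !cGammaE // cosTN (sinTN cb bN).
set c1 := cosT _ xi; set s1 := sinT _ xi; set c2 := cosT (egamma b) xi; set s2 := sinT (egamma b) xi.
have ic := integrable_cos cb bN xi; have js := integrable_sin cb bN xi.
have ica := integrable_cos ca aM xi; have jsa := integrable_sin ca aM xi.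
have Ec : cosT ecorr xi = c1 * c2 + s1 * s2.
  rewrite /cosT -(@correlation_exchange (fun x => cos (xi * x))); last 2 first.
  - exact: continuous_cosM.
  - by move=> x; exact: normr_cos_le1.
  rewrite [c1 * _]mulrC [s1 * _]mulrC.
  rewrite -(RintegralZl _ measurableT ica) -(RintegralZl _ measurableT jsa).
  rewrite -RintegralD //; [|exact: integrable_scale..].
  apply: eq_Rintegral => u _.
  transitivity (egamma a u * (cos (xi * u) * c2 + sin (xi * u) * s2)); last by ring.
  congr (_ * _); rewrite -(RintegralZl _ measurableT ic) -(RintegralZl _ measurableT js).
  rewrite -RintegralD //; [|exact: integrable_scale..].
  by apply: eq_Rintegral => v _; rewrite mulrBr cosB; ring.
have Es : sinT ecorr xi = c1 * s2 - s1 * c2.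
  rewrite /sinT -(@correlation_exchange (fun x => sin (xi * x))); last 2 first.
  - exact: continuous_sinM.
  - by move=> x; exact: normr_sin_le1.
  rewrite [c1 * _]mulrC [s1 * _]mulrC.
  rewrite -(RintegralZl _ measurableT ica) -(RintegralZl _ measurableT jsa).
  rewrite -RintegralB //; [|exact: integrable_scale..].
  apply: eq_Rintegral => u _.
  transitivity (egamma a u * (cos (xi * u) * s2 - sin (xi * u) * c2)); last by ring.
  congr (_ * _); rewrite -(RintegralZl _ measurableT ic) -(RintegralZl _ measurableT js).
  rewrite -RintegralB //; [|exact: integrable_scale..].
  by apply: eq_Rintegral => v _; rewrite mulrBr sinB; ring.
rewrite Ec Es; simpc; congr (_ +i* _); ring.
Qed.

Lemma ln_tanh (x : R) :
  ln (1 - tanh x) = ln 2 - ln (1 + expR (2 * x)) /\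
  ln (1 + tanh x) = ln 2 + 2 * x - ln (1 + expR (2 * x)).
Proof.
have e0 : 0 < 1 + expR (2 * x) by rewrite addr_gt0 ?expR_gt0.
have E : expR (2 * x) = expR x * expR x by rewrite -expRD; congr expR; ring.
have E1 : expR (- x) * expR x = 1 by rewrite -expRD addNr expR0.
have nz : expR x + expR (- x) != 0 by rewrite gt_eqF // expRDN_gt0.
have mz : 1 + expR (2 * x) != 0 by rewrite gt_eqF.
have h1 : 1 - tanh x = 2 / (1 + expR (2 * x)).
  rewrite onem_tanh; apply/eqP; rewrite (eqr_div _ _ nz mz); apply/eqP.
  have -> : 2 * expR (- x) * (1 + expR (2 * x)) = 2 * (expR (- x) + expR (- x) * expR x * expR x).
    by rewrite E; ring.
  by rewrite E1; ring.
have h2 : 1 + tanh x = 2 * expR (2 * x) / (1 + expR (2 * x)).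
  rewrite onep_tanh; apply/eqP; rewrite (eqr_div _ _ nz mz); apply/eqP.
  have -> : 2 * expR (2 * x) * (expR x + expR (- x)) =
    2 * expR x * (expR (2 * x) + expR (- x) * expR x) by rewrite E; ring.
  by rewrite E1; ring.
rewrite h1 h2 !ln_div ?posrE ?mulr_gt0 ?expR_gt0 // lnM ?posrE ?expR_gt0 // expRK.
by split.
Qed.

(** Translating by [h = ln (1 + exp (2 x)) / 2] replaces
    [exp (2 u) + exp (2 (x + u))] by [exp (2 u)]; what depends on [x] then comes
    out of the integral as [exp (2 b x) / (1 + exp (2 x))^(a + b)], which is
    [omega x] up to the power [2^(a + b)]. *)
Lemma ecorrE (x : R) : ecorr x =
  expR (- ((a + b) * ln 2)) * (\int[leb]_u egamma (a + b) u) * omega a b x.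
Proof.
pose G u := egamma a u * egamma b (x + u).
have cG : continuous G.
  apply: continuousMf; first exact: continuous_egamma.
  move=> u; apply: (@continuous_comp _ _ _ (fun v : R => x + v) (egamma b)).
    by apply: cvgD; [exact: cvg_cst|exact: cvg_id].
  exact: continuous_egamma.
pose h := ln (1 + expR (2 * x)) / 2.
have e0 : 0 < 1 + expR (2 * x) by rewrite addr_gt0 ?expR_gt0.
have [M abM] := egamma_bounded_by (addr_gt0 a0 b0).
have cab := @continuous_egamma (a + b).
have -> : ecorr x = \int[leb]_u G (u + - h) by rewrite Rintegral_translation.
have iab := integrable_bounded_by (continuous_measurable_fun cab) abM.
rewrite mulrAC -(RintegralZl _ measurableT iab).
apply: eq_Rintegral => u _; rewrite /G /egamma omegaE // -!expRD; congr expR.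
have [-> ->] := ln_tanh x.
have E1 : expR (2 * (u - h)) + expR (2 * (x + (u - h))) = expR (2 * u).
  have -> : 2 * (x + (u - h)) = 2 * (u - h) + 2 * x by ring.
  rewrite expRD -[X in X + _]mulr1 -mulrDr.
  have -> : 2 * (u - h) = 2 * u - ln (1 + expR (2 * x)) by rewrite /h; field.
  by rewrite expRD expRN lnK ?posrE // divfK // gt_eqF.
transitivity (2 * a * (u - h) + 2 * b * (x + (u - h)) -
  (expR (2 * (u - h)) + expR (2 * (x + (u - h))))); first by ring.
by rewrite E1 /h; field.
Qed.

End Product.
End GammaProduct.

(** * Probability measures given by a density *)

Section DensityMeasure.
Context {R : realType}.
Local Notation leb := (@lebesgue_measure R).
Variable w : R -> R.
Hypotheses (mw : measurable_fun setT w) (w0 : forall x, 0 <= w x).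
Hypothesis w1 : (\int[leb]_x (w x)%:E = 1)%E.

Lemma integrable_density : leb.-integrable setT (EFin \o w).
Proof.
apply/integrableP; split; first exact/measurable_EFinP.
by under eq_integral do rewrite /= ger0_norm //; rewrite w1 ltry.
Qed.

Definition density_measure (A : set (measurableTypeR R)) : \bar R :=
  (\int[leb]_(x in A) (w x)%:E)%E.

Let density0 : density_measure set0 = 0%E.
Proof. by rewrite /density_measure integral_set0. Qed.

Let density_ge0 A : (0 <= density_measure A)%E.
Proof. by apply: integral_ge0 => x _; rewrite lee_fin. Qed.

Let density_sigma_additive : semi_sigma_additive density_measure.
Proof.
move=> /= A mA tA mUA.
rewrite /density_measure/= integral_bigcup//=; last first.
  by apply: (integrableS _ _ (subsetT _)) => //; exact: integrable_density.
apply: is_cvg_ereal_nneg_natsum_cond => n _ _.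
by apply: integral_ge0 => /= x ?; rewrite lee_fin.
Qed.

HB.instance Definition _ := isMeasure.Build _ _ _
  density_measure density0 density_ge0 density_sigma_additive.

Let density_setT : density_measure [set: _] = 1%E.
Proof. exact: w1. Qed.

HB.instance Definition _ :=
  @Measure_isProbability.Build _ _ R density_measure density_setT.

Definition density_probability : probability (measurableTypeR R) R := density_measure.

Lemma density_probabilityP : has_density density_probability w.
Proof. by []. Qed.

Local Notation nu := density_probability.

Lemma density_dominated : nu `<< leb.
Proof.
apply/null_content_dominatesP => A mA A0; rewrite /= /density_measure.
apply: null_set_integral => //.
by apply: measurable_funTS; exact/measurable_EFinP.
Qed.

(** The density is almost everywhere the Radon-Nikodym derivative, for which the
    change of variables holds. *)
Lemma ge0_integral_density (f : R -> R) : measurable_fun setT f -> (forall x, 0 <= f x) ->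
  (\int[nu]_x (f x)%:E = \int[leb]_x (f x * w x)%:E)%E.
Proof.
move=> mf f0.
rewrite -(Radon_Nikodym_SigmaFinite.change_of_variables density_dominated) //; last first.
  exact/measurable_EFinP.
have idf := Radon_Nikodym_SigmaFinite.f_integrable density_dominated.
apply: ae_eq_integral => //.
- apply: emeasurable_funM; first exact/measurable_EFinP.
  exact: measurable_int idf.
- by apply/measurable_EFinP; exact: measurable_funM.
under [X in ae_eq _ _ _ X]eq_fun do rewrite EFinM.
apply: ae_eqe_mul2l; apply: integral_ae_eq => //.
  by apply/measurable_EFinP.
move=> A _ mA; rewrite -Radon_Nikodym_SigmaFinite.f_integral //.
exact: density_dominated.
Qed.

Lemma integrable_density_measure (f : R -> R) : measurable_fun setT f ->
  leb.-integrable setT (EFin \o (fun x => f x * w x)) ->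
  nu.-integrable setT (EFin \o f).
Proof.
move=> mf /integrableP[_ ifw]; apply/integrableP; split; first exact/measurable_EFinP.
rewrite /= ge0_integral_density //; last exact: measurableT_comp.
apply: le_lt_trans ifw; rewrite le_eqVlt; apply/orP; left; apply/eqP.
by apply: eq_integral => x _; rewrite /= normrM (ger0_norm (w0 _)).
Qed.

Lemma integral_density (f : R -> R) : measurable_fun setT f ->
  leb.-integrable setT (EFin \o (fun x => f x * w x)) ->
  (\int[nu]_x (f x)%:E = \int[leb]_x (f x * w x)%:E)%E.
Proof.
move=> mf ifw; rewrite integralE [RHS]integralE.
have mp : measurable_fun setT (fun x => Num.max (f x) 0) by exact: measurable_maxr.
have mn : measurable_fun setT (fun x => Num.max (- f x) 0).
  by apply: measurable_maxr => //; exact: measurableT_comp.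
congr (_ - _)%E.
- transitivity (\int[nu]_x (Num.max (f x) 0)%:E)%E.
    by apply: eq_integral => x _; rewrite funeposE EFin_max.
  rewrite ge0_integral_density //; last by move=> x; rewrite le_max lexx orbT.
  by apply: eq_integral => x _; rewrite funeposE -EFin_max maxr_pMl // mul0r.
- transitivity (\int[nu]_x (Num.max (- f x) 0)%:E)%E.
    by apply: eq_integral => x _; rewrite funenegE EFin_max.
  rewrite ge0_integral_density //; last by move=> x; rewrite le_max lexx orbT.
  by apply: eq_integral => x _; rewrite funenegE -EFinN -EFin_max maxr_pMl // mul0r mulNr.
Qed.

End DensityMeasure.

(** * The Fourier transform of the tanh-Jacobi functions *)

Import ComplexField.Normc.
Section FourierTransformOfTanhClass.
Context {R : realType}.
Local Notation leb := (@lebesgue_measure R).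
Local Open Scope complex_scope.
Local Notation I := (0 +i* 1 : R[i]).
Variables a b : R.
Hypotheses (a0 : 0 < a) (b0 : 0 < b).
Local Notation S := (tanh_class a b).
Local Notation L := (tanh_deriv a b).
Local Notation q := (jacobi_on a b).
Local Notation p := (fourier_poly a b).

Let dS r := isder_tanh_class a b r.
Let cS r := @continuous_tanh_class R a b r.

Lemma cosT_tanh_deriv r xi : cosT (S (L r)) xi = xi * sinT (S r) xi.
Proof.
have [M rM] := tanh_class_bounded_by a0 b0 r; have [N rN] := tanh_class_bounded_by a0 b0 (L r).
exact: (cosT_derivative (@cS r) rM (@dS r) (@cS (L r)) rN).
Qed.

Lemma sinT_tanh_deriv r xi : sinT (S (L r)) xi = - (xi * cosT (S r) xi).
Proof.
have [M rM] := tanh_class_bounded_by a0 b0 r; have [N rN] := tanh_class_bounded_by a0 b0 (L r).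
exact: (sinT_derivative (@cS r) rM (@dS r) (@cS (L r)) rN).
Qed.

Lemma cosT_sinT_tanh_class_bounded_by r : exists K : R, forall xi,
  `|cosT (S r) xi| <= K / oneDsqr xi /\ `|sinT (S r) xi| <= K / oneDsqr xi.
Proof.
have [M rM] := tanh_class_bounded_by a0 b0 r.
have [N rN] := tanh_class_bounded_by a0 b0 (L r).
have [N' rN'] := tanh_class_bounded_by a0 b0 (L (L r)).
exists (M * pi + N' * pi) => xi; split.
  exact: (cosT_bounded_by rM rN rN' (@dS r) (@dS (L r)) (@cS (L (L r)))).
exact: (sinT_bounded_by rM rN rN' (@dS r) (@dS (L r)) (@cS (L (L r)))).
Qed.

(** Multiplication by [xi] is, up to sign, the exchange of the two transforms
    together with [L], and [L r] is again a polynomial. *)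
Lemma moment_bounded_by n : forall r, exists K : R, forall xi,
  `|xi ^+ n * cosT (S r) xi| <= K / oneDsqr xi /\
  `|xi ^+ n * sinT (S r) xi| <= K / oneDsqr xi.
Proof.
elim: n => [|n IH] r.
  have [K rK] := cosT_sinT_tanh_class_bounded_by r; exists K => xi.
  by rewrite expr0 !mul1r.
have [K LK] := IH (L r); exists K => xi; have [h1 h2] := LK xi.
split; rewrite exprSr -mulrA.
  have -> : xi * cosT (S r) xi = - sinT (S (L r)) xi by rewrite sinT_tanh_deriv opprK.
  by rewrite mulrN normrN.
by rewrite -cosT_tanh_deriv.
Qed.

Lemma integrable_tanh_cos r xi : leb.-integrable setT (EFin \o (fun x => S r x * cos (xi * x))).
Proof. by have [M rM] := tanh_class_bounded_by a0 b0 r; exact: (integrable_cos (@cS r) rM xi). Qed.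

Lemma integrable_tanh_sin r xi : leb.-integrable setT (EFin \o (fun x => S r x * sin (xi * x))).
Proof. by have [M rM] := tanh_class_bounded_by a0 b0 r; exact: (integrable_sin (@cS r) rM xi). Qed.

(** The integral of [tanh_class r x * exp (- i xi x)] over the line. *)
Definition FT (r : {poly R}) (xi : R) : R[i] := cosT (S r) xi -i* sinT (S r) xi.

Lemma FTD r s xi : FT (r + s) xi = FT r xi + FT s xi.
Proof.
rewrite /FT; simpc; congr (_ +i* _).
- rewrite /cosT -RintegralD //; [|exact: integrable_tanh_cos..].
  by apply: eq_Rintegral => x _; rewrite tanh_classD mulrDl.
- rewrite -opprD; congr (- _); rewrite /sinT -RintegralD //; [|exact: integrable_tanh_sin..].
  by apply: eq_Rintegral => x _; rewrite tanh_classD mulrDl.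
Qed.

Lemma FTZ c r xi : FT (c *: r) xi = c%:C * FT r xi.
Proof.
rewrite /FT; simpc; congr (_ +i* _).
- rewrite /cosT -RintegralZl //; last exact: integrable_tanh_cos.
  by apply: eq_Rintegral => x _; rewrite tanh_classZ mulrA.
- congr (- _); rewrite /sinT -RintegralZl //; last exact: integrable_tanh_sin.
  by apply: eq_Rintegral => x _; rewrite tanh_classZ mulrA.
Qed.

Lemma FT_tanh_deriv r xi : FT (L r) xi = I * xi%:C * FT r xi.
Proof. by rewrite /FT cosT_tanh_deriv sinT_tanh_deriv; simpc. Qed.

Let bC_neq0 m : (jacobi_b a b m)%:C != 0 :> R[i].
Proof. by rewrite eq_complex /= eqxx andbT gt_eqF // jacobi_b_gt0. Qed.

(** By induction on pairs of consecutive indices: transforming the three-term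
    relation of the [q m] gives that of the [p m], the powers of [i] absorbing
    the sign. *)
Lemma FT_jacobi_on m xi : FT (q m) xi = I ^+ m * (p m).[xi]%:C * FT (q 0%N) xi.
Proof.
suff: FT (q m) xi = I ^+ m * (p m).[xi]%:C * FT (q 0%N) xi /\
      FT (q m.+1) xi = I ^+ m.+1 * (p m.+1).[xi]%:C * FT (q 0%N) xi by case.
elim: m => [|m [IH0 IH1]].
  split; first by rewrite expr0 mul1r fourier_poly0 hornerC mul1r.
  apply: (mulfI (bC_neq0 0)); rewrite -FTZ -tanh_deriv_jacobi0 // FT_tanh_deriv.
  have := congr1 (fun r => r.[xi]) (fourier_poly1 a0 b0); rewrite hornerZ hornerX => E.
  have E' : xi%:C = (jacobi_b a b 0)%:C * (p 1%N).[xi]%:C by rewrite -rmorphM /= E.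
  rewrite expr1 E'; move: ((jacobi_b a b 0)%:C) ((p 1%N).[xi]%:C) (FT _ _) I => u v w i.
  by ring.
split => //; apply: (mulfI (bC_neq0 m.+1)).
have E := congr1 (fun r => r.[xi]) (fourier_polySS a0 b0 m).
rewrite hornerD hornerN hornerM hornerX !hornerZ in E.
have -> : (jacobi_b a b m.+1)%:C * FT (q m.+2) xi =
    I * xi%:C * FT (q m.+1) xi + (jacobi_b a b m)%:C * FT (q m) xi.
  rewrite -FTZ -FT_tanh_deriv tanh_deriv_jacobiS // -FTZ -FTD.
  by rewrite subrK.
have I2 : I * I = -1 by simpc.
have BE : (jacobi_b a b m.+1)%:C * (p m.+2).[xi]%:C =
    xi%:C * (p m.+1).[xi]%:C - (jacobi_b a b m)%:C * (p m).[xi]%:C.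
  by rewrite -!rmorphM -rmorphB /= E.
rewrite IH0 IH1 !exprS; move: (FT _ _) => z.
rewrite [RHS](_ : _ = (I * I) * I ^+ m * ((jacobi_b a b m.+1)%:C * (p m.+2).[xi]%:C) * z); last first.
  by move: (_%:C) (_%:C) I => u v i; ring.
rewrite BE; rewrite [LHS](_ : _ = (I * I) * I ^+ m * (xi%:C * (p m.+1).[xi]%:C) * z +
  I ^+ m * ((jacobi_b a b m)%:C * (p m).[xi]%:C) * z); last first.
  by move: (_%:C) (_%:C) (_%:C) (_%:C) I => u v w t i; ring.
by rewrite I2; move: (_ * _) (_%:C * _) (I ^+ m) => u v i; ring.
Qed.

Lemma tanh_jacobiE m x : tanh_jacobi (2 * a - 1) (2 * b - 1) m x = S (q m) x.
Proof.
rewrite /tanh_jacobi jacobi_norm_jint // /tanh_class /jacobi_on hornerZ /omega.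
have -> : (2 * a - 1 + 1) / 2 = a by field.
have -> : (2 * b - 1 + 1) / 2 = b by field.
move: (Num.sqrt _)^-1 (_ `^ a) (_ `^ b) (_.[_]) ((-1) ^+ m) => s u v w e.
by ring.
Qed.

Lemma Parseval_jacobi_on m n :
  \int[leb]_xi (cosT (S (q m)) xi * cosT (S (q n)) xi + sinT (S (q m)) xi * sinT (S (q n)) xi) =
  2 * pi * (m == n)%:R.
Proof.
have [M mM] := tanh_class_bounded_by a0 b0 (q m); have [N nN] := tanh_class_bounded_by a0 b0 (q n).
have [K mK] := cosT_sinT_tanh_class_bounded_by (q m).
rewrite (Parseval (@cS (q m)) mM (fun xi => (mK xi).1) (fun xi => (mK xi).2) (@cS (q n)) nN).
by rewrite -jintM jacobi_on_orthonormal.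
Qed.

Lemma transform_products_integrable (r s : {poly R}) :
  [/\ leb.-integrable setT (EFin \o (fun xi => cosT (S r) xi * cosT (S s) xi)),
     leb.-integrable setT (EFin \o (fun xi => sinT (S r) xi * sinT (S s) xi)),
     leb.-integrable setT (EFin \o (fun xi => cosT (S r) xi * sinT (S s) xi)) &
     leb.-integrable setT (EFin \o (fun xi => sinT (S r) xi * cosT (S s) xi))].
Proof.
have [M rM] := tanh_class_bounded_by a0 b0 r; have [N sN] := tanh_class_bounded_by a0 b0 s.
have [K rK] := cosT_sinT_tanh_class_bounded_by r; have [K' sK] := cosT_sinT_tanh_class_bounded_by s.
have cc1 := continuous_cosT (@cS r) rM; have cc2 := continuous_cosT (@cS s) sN.
have cs1 := continuous_sinT (@cS r) rM; have cs2 := continuous_sinT (@cS s) sN.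
have prod (f g : R -> R) : continuous f -> continuous g -> (forall x, `|f x| <= K / oneDsqr x) ->
    (forall x, `|g x| <= K' / oneDsqr x) ->
    leb.-integrable setT (EFin \o (fun x => f x * g x)).
  move=> cf cg fK gK; apply: (@integrable_bounded_by _ (K * K')).
    by apply: continuous_measurable_fun; exact: continuousMf.
  move=> x; rewrite normrM mulrAC ler_pM // (le_trans (gK x)) // ler_piMr ?oneDsqrV_le1 //.
  exact: bounded_by_ge0 gK.
by split; apply: prod => // x; by [case: (rK x)|case: (sK x)].
Qed.

Lemma Rintegral_transforms_odd m n :
  \int[leb]_xi (cosT (S (q m)) xi * sinT (S (q n)) xi - sinT (S (q m)) xi * cosT (S (q n)) xi) = 0.
Proof.
have [M mM] := tanh_class_bounded_by a0 b0 (q m); have [N nN] := tanh_class_bounded_by a0 b0 (q n).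
have [_ _ i1 i2] := transform_products_integrable (q m) (q n).
have cc1 := continuous_cosT (@cS (q m)) mM; have cc2 := continuous_cosT (@cS (q n)) nN.
have cs1 := continuous_sinT (@cS (q m)) mM; have cs2 := continuous_sinT (@cS (q n)) nN.
apply: Rintegral_odd.
- by move=> x; apply: cvgB; apply: continuousMf.
- move=> x; rewrite !cosTN (sinTN (@cS _) mM) (sinTN (@cS _) nN); ring.
- have := integrableB measurableT i1 i2; apply: eq_integrable => // x _.
Qed.

Definition fourier_density (xi : R) : R :=
  (2 * pi)^-1 * (cosT (S (q 0%N)) xi ^+ 2 + sinT (S (q 0%N)) xi ^+ 2).

Lemma fourier_density_ge0 xi : 0 <= fourier_density xi.
Proof. by rewrite mulr_ge0 ?invr_ge0 ?mulr_ge0 ?pi_ge0 // addr_ge0 ?sqr_ge0. Qed.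

Lemma measurable_fourier_density : measurable_fun setT fourier_density.
Proof.
have [M mM] := tanh_class_bounded_by a0 b0 (q 0%N).
have mc := continuous_measurable_fun (continuous_cosT (@cS (q 0%N)) mM).
have ms := continuous_measurable_fun (continuous_sinT (@cS (q 0%N)) mM).
by apply: measurable_funM => //; apply: measurable_funD; exact: measurable_funX.
Qed.

Let pi2_neq0 : 2 * pi != 0 :> R. Proof. by rewrite mulf_neq0 // gt_eqF // pi_gt0. Qed.

Lemma fourier_density_integrable : leb.-integrable setT (EFin \o fourier_density).
Proof.
have [i1 i2 _ _] := transform_products_integrable (q 0%N) (q 0%N).
have := integrable_scale (2 * pi)^-1 (integrable_add i1 i2).
by apply: eq_integrable => // x _; rewrite /fourier_density !expr2.
Qed.

Lemma fourier_density_total : (\int[leb]_xi (fourier_density xi)%:E = 1)%E.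
Proof.
have fi := fourier_density_integrable.
rewrite -[LHS]fineK; last exact: integrable_fin_num.
congr EFin; rewrite -/(Rintegral _ _ _).
have [i1 i2 _ _] := transform_products_integrable (q 0%N) (q 0%N).
rewrite /fourier_density RintegralZl //; last first.
  by have := integrable_add i1 i2; apply: eq_integrable => // x _; rewrite !expr2.
transitivity ((2 * pi)^-1 * (2 * pi * (0%N == 0%N)%:R) : R); last by rewrite eqxx mulr1 mulVf.
by rewrite -Parseval_jacobi_on; congr (_ * _); apply: eq_Rintegral => x _; rewrite !expr2.
Qed.

Lemma conjc_FT_jacobi_on m xi : cosT (S (q m)) xi +i* sinT (S (q m)) xi =
  (- I) ^+ m * (p m).[xi]%:C * (cosT (S (q 0%N)) xi +i* sinT (S (q 0%N)) xi).
Proof.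
have := congr1 (@conjc R) (FT_jacobi_on m xi).
rewrite rmorphM rmorphM rmorphXn /= !opprK oppr0 => ->.
by congr (_ ^+ m * _ * _); simpc.
Qed.

(** Both [p_m(xi) FT (q 0)] and [p_n(xi) FT (q 0)] are transforms up to the units
    [i^m], [i^n]; so [p_m p_n |FT (q 0)|^2] is, up to a unit [z], the product of
    one transform by the conjugate of another. *)
Lemma fourier_poly_product m n : exists z : R[i], (m = n -> z = 1) /\
  forall xi, (p m).[xi] * (p n).[xi] * fourier_density xi =
  (2 * pi)^-1 * (complex.Re z *
    (cosT (S (q m)) xi * cosT (S (q n)) xi + sinT (S (q m)) xi * sinT (S (q n)) xi)
  - complex.Im z * (cosT (S (q m)) xi * sinT (S (q n)) xi - sinT (S (q m)) xi * cosT (S (q n)) xi)).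
Proof.
have IJ : (- I) * I = 1 by simpc.
exists ((- I) ^+ m * I ^+ n); split=> [->|xi]; first by rewrite -exprMn IJ expr1n.
have Em := FT_jacobi_on m xi; have En := conjc_FT_jacobi_on n xi.
set z := (- I) ^+ m * I ^+ n.
rewrite /fourier_density mulrCA; congr (_ * _).
set X := _ + sinT (S (q m)) xi * _; set Y := _ - sinT (S (q m)) xi * _.
have XY : FT (q m) xi * (cosT (S (q n)) xi +i* sinT (S (q n)) xi) = X +i* Y.
  by rewrite /FT; simpc; congr (_ +i* _); rewrite /X /Y; ring.
have F0 : FT (q 0%N) xi * (cosT (S (q 0%N)) xi +i* sinT (S (q 0%N)) xi) =
    (cosT (S (q 0%N)) xi ^+ 2 + sinT (S (q 0%N)) xi ^+ 2)%:C.
  by rewrite /FT; simpc; congr (_ +i* _); ring.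
have : ((p m).[xi] * (p n).[xi] * (cosT (S (q 0%N)) xi ^+ 2 + sinT (S (q 0%N)) xi ^+ 2))%:C =
    z * (X +i* Y).
  have cM (u v : R) : (u * v)%:C = u%:C * v%:C by rewrite -rmorphM.
  rewrite -XY Em En /z !cM -F0.
  have h1 : (- I) ^+ m * I ^+ m = 1 by rewrite -exprMn IJ expr1n.
  have h2 : (- I) ^+ n * I ^+ n = 1 by rewrite -exprMn IJ expr1n.
  move: (FT _ _) (_ +i* _) (_.[_]%:C) (_.[_]%:C) ((- I) ^+ m) ((- I) ^+ n) (I ^+ m) (I ^+ n)
    h1 h2 => u v s t i j k l h1 h2.
  transitivity ((i * k) * (j * l) * (s * t * (u * v))); last by ring.
  by rewrite h1 h2 !mul1r (mulrC s).
by case: z => zr zi; simpc => -[-> _].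
Qed.

(** The real part of the product of transforms integrates to [2 pi] times the
    inner product of [q m] and [q n], by Parseval's identity, and the imaginary
    part is odd. *)
Lemma fourier_poly_orthonormal m n :
  leb.-integrable setT (EFin \o (fun xi => (p m).[xi] * (p n).[xi] * fourier_density xi)) /\
  \int[leb]_xi ((p m).[xi] * (p n).[xi] * fourier_density xi) = (m == n)%:R.
Proof.
have [z [z1 zE]] := fourier_poly_product m n.
have [i1 i2 i3 i4] := transform_products_integrable (q m) (q n).
have i12 := integrable_add i1 i2.
have i34 : leb.-integrable setT (EFin \o (fun xi =>
    cosT (S (q m)) xi * sinT (S (q n)) xi - sinT (S (q m)) xi * cosT (S (q n)) xi)).
  by have := integrableB measurableT i3 i4; apply: eq_integrable => // x _.
have jA := integrable_scale (complex.Re z) i12.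
have jB := integrable_scale (- complex.Im z) i34.
have jC := integrable_scale (2 * pi)^-1 (integrable_add jA jB).
have fE xi : (p m).[xi] * (p n).[xi] * fourier_density xi = (2 * pi)^-1 *
  (complex.Re z * (cosT (S (q m)) xi * cosT (S (q n)) xi + sinT (S (q m)) xi * sinT (S (q n)) xi) +
   - complex.Im z * (cosT (S (q m)) xi * sinT (S (q n)) xi - sinT (S (q m)) xi * cosT (S (q n)) xi)).
  by rewrite zE mulNr.
split.
  by move: jC; apply: eq_integrable => // xi _; rewrite /= fE.
under eq_Rintegral do rewrite fE.
rewrite RintegralZl //; last exact: integrable_add jA jB.
rewrite RintegralD // RintegralZl // RintegralZl // Parseval_jacobi_on Rintegral_transforms_odd.
rewrite mulr0 addr0; have [mn|_] := eqVneq m n; last by rewrite !mulr0.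
by rewrite z1 //= mulr1 mul1r mulVf.
Qed.

Lemma fourier_density_moments k :
  leb.-integrable setT (EFin \o (fun xi => xi ^+ k * fourier_density xi)).
Proof.
have [M mM] := tanh_class_bounded_by a0 b0 (q 0%N).
have cc := continuous_cosT (@cS (q 0%N)) mM; have cs := continuous_sinT (@cS (q 0%N)) mM.
have [K kK] := moment_bounded_by k (q 0%N).
have [K' kK'] := cosT_sinT_tanh_class_bounded_by (q 0%N).
have prod (f : R -> R) : continuous f -> (forall x, `|x ^+ k * f x| <= K / oneDsqr x) ->
    (forall x, `|f x| <= K' / oneDsqr x) ->
    leb.-integrable setT (EFin \o (fun x => x ^+ k * f x * f x)).
  move=> cf fK gK; apply: (@integrable_bounded_by _ (K * K')).
    apply: continuous_measurable_fun; apply: continuousMf => //; apply: continuousMf => //.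
    exact: exprn_continuous.
  move=> x; rewrite normrM mulrAC ler_pM // (le_trans (gK x)) // ler_piMr ?oneDsqrV_le1 //.
  exact: bounded_by_ge0 gK.
have i1 := prod _ cc (fun x => (kK x).1) (fun x => (kK' x).1).
have i2 := prod _ cs (fun x => (kK x).2) (fun x => (kK' x).2).
have := integrable_scale (2 * pi)^-1 (integrable_add i1 i2).
apply: eq_integrable => // x _ /=; rewrite /fourier_density; congr EFin.
by move: (cosT _ _) (sinT _ _) => c s; ring.
Qed.

Lemma cintegralZ (z : R[i]) (h : R -> R[i]) : cintegrable setT h ->
  cintegrable setT (fun x => z * h x) /\
  cintegral setT (fun x => z * h x) = z * cintegral setT h.
Proof.
case=> hr hi; case: z => zr zi.
have ReE x : complex.Re ((zr +i* zi) * h x) = zr * complex.Re (h x) + - zi * complex.Im (h x).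
  by case: (h x) => u v; simpc.
have ImE x : complex.Im ((zr +i* zi) * h x) = zr * complex.Im (h x) + zi * complex.Re (h x).
  by case: (h x) => u v; simpc.
have i1 := integrable_scale zr hr; have i2 := integrable_scale (- zi) hi.
have i3 := integrable_scale zr hi; have i4 := integrable_scale zi hr.
split.
  by split; [move: (integrable_add i1 i2)|move: (integrable_add i3 i4)];
    apply: eq_integrable => // x _ /=; rewrite ?ReE ?ImE.
rewrite /cintegral; simpc; congr (_ +i* _).
- under eq_Rintegral do rewrite ReE.
  by rewrite RintegralD // RintegralZl // RintegralZl // mulNr.
- under eq_Rintegral do rewrite ImE.
  by rewrite RintegralD // RintegralZl // RintegralZl // addrC.
Qed.

Lemma FT_inversion r x :
  cintegrable setT (fun xi => FT r xi * cis (x * xi)) /\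
  cintegral setT (fun xi => FT r xi * cis (x * xi)) = (2 * pi * S r x)%:C.
Proof.
have [M rM] := tanh_class_bounded_by a0 b0 r.
have [K rK] := cosT_sinT_tanh_class_bounded_by r.
have cK xi := (rK xi).1; have sK xi := (rK xi).2.
have cc := continuous_cosT (@cS r) rM; have cs := continuous_sinT (@cS r) rM.
have ReE xi : complex.Re (FT r xi * cis (x * xi)) =
    cosT (S r) xi * cos (xi * x) + sinT (S r) xi * sin (xi * x).
  by rewrite /FT /cis; simpc; rewrite /= (mulrC x).
have ImE xi : complex.Im (FT r xi * cis (x * xi)) =
    cosT (S r) xi * sin (xi * x) - sinT (S r) xi * cos (xi * x).
  by rewrite /FT /cis; simpc; rewrite /= (mulrC x).
have i1 := integrable_bounded_by
  (continuous_measurable_fun (continuous_inversion_integrand (@cS r) rM (x := x)))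
  (inversion_integrand_bounded_by cK sK x).
have ci := continuous_inversion_conjugate (@cS r) rM (x := x).
have i2 := integrable_bounded_by (continuous_measurable_fun ci)
  (inversion_conjugate_bounded_by cK sK x).
split.
  split.
    apply: eq_integrable i1 => // xi _.
    by congr EFin; rewrite ReE.
  apply: eq_integrable i2 => // xi _.
  by congr EFin; rewrite ImE.
rewrite /cintegral; congr (_ +i* _).
- under eq_Rintegral do rewrite ReE.
  exact: (Fourier_inversion (@cS r) rM cK sK).
- under eq_Rintegral do rewrite ImE.
  exact: (Rintegral_inversion_odd (@cS r) rM cK sK).
Qed.

Definition fourier_function (xi : R) : R[i] := (Num.sqrt (2 * pi))^-1%:C * FT (q 0%N) xi.

Lemma normc_fourier_function xi : normc (fourier_function xi) ^+ 2 = fourier_density xi.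
Proof.
rewrite /fourier_function /FT; simpc; rewrite /normc sqr_sqrtr; last first.
  by rewrite addr_ge0 ?sqr_ge0.
rewrite /fourier_density.
have -> : (2 * pi)^-1 = (Num.sqrt (2 * pi))^-1 ^+ 2 :> R.
  by rewrite exprVn sqr_sqrtr // mulr_ge0 // pi_ge0.
by ring.
Qed.

Lemma tanh_class_fourier m x :
  let integrand := fun xi => fourier_function xi * (p m).[xi]%:C * cis (x * xi) in
  cintegrable setT integrand /\
  (S (q m) x)%:C = I ^+ m / (Num.sqrt (2 * pi))%:C * cintegral setT integrand.
Proof.
have s0 : Num.sqrt (2 * pi) != 0 :> R by rewrite gt_eqF // sqrtr_gt0 mulr_gt0 // pi_gt0.
have s2 : Num.sqrt (2 * pi) * Num.sqrt (2 * pi) = 2 * pi :> R.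
  by rewrite -expr2 sqr_sqrtr // mulr_ge0 // pi_ge0.
have I0 : I != 0 by rewrite eq_complex /= oner_eq0 andbF.
pose z : R[i] := (Num.sqrt (2 * pi))^-1%:C / I ^+ m.
have zE : (fun xi => fourier_function xi * (p m).[xi]%:C * cis (x * xi)) =
    (fun xi => z * (FT (q m) xi * cis (x * xi))).
  apply/funext => xi; rewrite FT_jacobi_on /fourier_function /z.
  have : I ^+ m != 0 by rewrite expf_neq0.
  move: ((Num.sqrt (2 * pi))^-1)%:C (FT _ _) (cis _) ((p m).[xi])%:C (I ^+ m) => u v w t i i0.
  by field.
have [h1 h2] := FT_inversion (q m) x.
have [h3 h4] := cintegralZ z h1.
move=> integrand; rewrite /integrand zE; split => //.
rewrite h4 h2 /z mulrA.
have -> : I ^+ m / (Num.sqrt (2 * pi))%:C * ((Num.sqrt (2 * pi))^-1%:C / I ^+ m) =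
    ((Num.sqrt (2 * pi))^-1 * (Num.sqrt (2 * pi))^-1)%:C.
  rewrite -[(Num.sqrt (2 * pi))%:C^-1]fmorphV rmorphM /=.
  have : I ^+ m != 0 by rewrite expf_neq0.
  move: ((Num.sqrt (2 * pi))^-1)%:C (I ^+ m) => u i i0.
  by field.
rewrite -rmorphM /=; congr (_%:C); move: (tanh_class _ _ _ _) => y.
by move: s0 s2; move: (Num.sqrt _) => s s0 <-; field.
Qed.

Lemma jacobi_on0 : exists2 k : R, 0 < k & q 0%N = k%:P.
Proof.
have := lead_coef_jacobi_on_sign a0 b0 0; rewrite expr0 mul1r => h.
exists (lead_coef (q 0%N)) => //.
have /size1_polyC qE : (size (q 0%N) <= 1)%N by rewrite size_jacobi_on.
by rewrite {1}qE /lead_coef size_jacobi_on.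
Qed.

(** [q 0] is a positive constant, and the correlation [ecorr] is a positive
    multiple of [omega]: the two transforms are proportional. *)
Lemma cGamma_prod_FT : exists2 C : R, 0 < C & forall xi,
  fourier_function xi = C%:C * (cGamma (a +i* (xi / 2)) * cGamma (b -i* (xi / 2))).
Proof.
have [k k0 q0E] := jacobi_on0.
have [M abM] := egamma_bounded_by (addr_gt0 a0 b0).
pose K := expR (- ((a + b) * ln 2)) * (\int[leb]_u egamma (a + b) u).
have K0 : 0 < K.
  rewrite mulr_gt0 ?expR_gt0 //.
  apply: (@continuous_Rintegral_gt0 _ _ 0 M) => //.
  - exact: continuous_egamma.
  - by move=> x; rewrite ltW // egamma_gt0.
  - exact: egamma_gt0.
have s0 : 0 < Num.sqrt (2 * pi) :> R by rewrite sqrtr_gt0 mulr_gt0 // pi_gt0.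
exists ((Num.sqrt (2 * pi))^-1 * k / (4 * K)).
  by rewrite divr_gt0 // mulr_gt0 // invr_gt0.
move=> xi; rewrite cGamma_prod //.
have q0S x : S (q 0%N) x = k * S 1 x by rewrite q0E -alg_polyC tanh_classZ.
have eS x : ecorr a b x = K * S 1 x by rewrite ecorrE // omega1.
have ic := integrable_tanh_cos 1 xi; have js := integrable_tanh_sin 1 xi.
have c1 : cosT (S (q 0%N)) xi = k * cosT (S 1) xi.
  by rewrite /cosT -(RintegralZl _ measurableT ic); apply: eq_Rintegral => x _; rewrite q0S mulrA.
have c2 : cosT (ecorr a b) xi = K * cosT (S 1) xi.
  by rewrite /cosT -(RintegralZl _ measurableT ic); apply: eq_Rintegral => x _; rewrite eS mulrA.
have s1 : sinT (S (q 0%N)) xi = k * sinT (S 1) xi.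
  by rewrite /sinT -(RintegralZl _ measurableT js); apply: eq_Rintegral => x _; rewrite q0S mulrA.
have s2 : sinT (ecorr a b) xi = K * sinT (S 1) xi.
  by rewrite /sinT -(RintegralZl _ measurableT js); apply: eq_Rintegral => x _; rewrite eS mulrA.
rewrite /fourier_function /FT c1 c2 s1 s2; simpc.
move: (cosT _ _) (sinT _ _) => c s.
by congr (_ +i* _); field; rewrite !gt_eqF.
Qed.

End FourierTransformOfTanhClass.

(** * The Fourier-space measure *)

Section FourierSpaceMeasureOfTanhJacobi.
Context {R : realType}.
Local Notation leb := (@lebesgue_measure R).
Local Open Scope complex_scope.
Variables a b : R.
Hypotheses (a0 : 0 < a) (b0 : 0 < b).

Let nu := density_probability (measurable_fourier_density a0 b0)
  (fourier_density_ge0 a b) (fourier_density_total a0 b0).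

Lemma density_finite_moments : finite_moments nu.
Proof.
move=> k; apply: integrable_density_measure; last exact: fourier_density_moments.
by apply: measurable_funX; exact: measurable_id.
Qed.

Lemma density_orthonormal_polynomials : orthonormal_polynomials nu (fourier_poly a b).
Proof.
split=> [m|m|m n]; [by case: (fourier_poly_size_lead a0 b0 m)..|].
have mp k : measurable_fun setT (fun xi : R => (fourier_poly a b k).[xi]).
  by apply: continuous_measurable_fun; exact: continuous_horner.
have [pi1 pE] := fourier_poly_orthonormal a0 b0 m n.
rewrite (integral_density _ _ _ (measurable_funM (mp m) (mp n)) pi1).
by rewrite -[LHS]fineK ?integrable_fin_num //; congr EFin.
Qed.

Lemma fourier_density_gamma_weight : exists2 C : R, 0 < C &
  fourier_density a b = gamma_weight (2 * a - 1) (2 * b - 1) C.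
Proof.
have [C C0 CE] := cGamma_prod_FT a0 b0; exists C => //; apply/funext => xi.
rewrite -normc_fourier_function CE /gamma_weight.
have -> : (2 * a - 1 + 1) / 2 = a by field.
have -> : (2 * b - 1 + 1) / 2 = b by field.
have nC : normc C%:C = C by rewrite /= expr0n addr0 sqrtr_sqr gtr0_norm.
by rewrite normcM exprMn nC.
Qed.

Lemma density_fourier_space_measure :
  is_fourier_space_measure (tanh_jacobi (2 * a - 1) (2 * b - 1)) nu.
Proof.
split; first exact: density_finite_moments.
have [M SM] := tanh_class_bounded_by a0 b0 (jacobi_on a b 0).
have cS := @continuous_tanh_class R a b (jacobi_on a b 0).
have ReE xi : complex.Re (fourier_function a b xi) =
    (Num.sqrt (2 * pi))^-1 * cosT (tanh_class a b (jacobi_on a b 0)) xi.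
  by rewrite /fourier_function /FT; simpc.
have ImE xi : complex.Im (fourier_function a b xi) =
    - ((Num.sqrt (2 * pi))^-1 * sinT (tanh_class a b (jacobi_on a b 0)) xi).
  by rewrite /fourier_function /FT; simpc.
exists (fourier_function a b), (fourier_poly a b); split.
- split.
  + under eq_fun do rewrite ReE.
    apply: measurable_funM => //.
    by apply: continuous_measurable_fun; exact: continuous_cosT cS SM.
  + under eq_fun do rewrite ImE.
    apply: measurableT_comp => //; apply: measurable_funM => //.
    by apply: continuous_measurable_fun; exact: continuous_sinT cS SM.
- by under eq_fun do rewrite normc_fourier_function; exact: density_probabilityP.
- split=> xi; first by rewrite !ReE cosTN.
  by rewrite !ImE (sinTN cS SM) mulrN.
- exact: density_orthonormal_polynomials.
- move=> m x; rewrite tanh_jacobiE //; exact: tanh_class_fourier.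
Qed.

(** The weight is quadratic in the constant, and the constant [C] gives total
    mass one. *)
Lemma integral_gamma_weight C C' : 0 < C ->
  fourier_density a b = gamma_weight (2 * a - 1) (2 * b - 1) C ->
  (\int[leb]_(xi in [set: R]) (gamma_weight (2 * a - 1) (2 * b - 1) C' xi)%:E)%E =
  ((C' / C) ^+ 2)%:E.
Proof.
move=> C0 wE.
have gE xi : gamma_weight (2 * a - 1) (2 * b - 1) C' xi =
    (C' / C) ^+ 2 * fourier_density a b xi.
  by rewrite wE /gamma_weight mulrA; congr (_ * _); field; rewrite gt_eqF.
under eq_integral do rewrite gE EFinM.
rewrite integralZl //; last exact: fourier_density_integrable.
by rewrite fourier_density_total // mule1.
Qed.

Lemma tanh_jacobi_fourier_space_measure : exists C : R,
  (forall C' : R,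
     (\int[leb]_(xi in [set: R]) (gamma_weight (2 * a - 1) (2 * b - 1) C' xi)%:E)%E = 1%:E
     <-> C' = C \/ C' = - C) /\
  exists mu : probability (measurableTypeR R) R,
    has_density mu (gamma_weight (2 * a - 1) (2 * b - 1) C) /\
    is_fourier_space_measure (tanh_jacobi (2 * a - 1) (2 * b - 1)) mu.
Proof.
have [C C0 wE] := fourier_density_gamma_weight.
have Cn0 : C != 0 by rewrite gt_eqF.
exists C; split=> [C'|].
  rewrite (integral_gamma_weight _ C0 wE); split=> [[CC]|CC].
    have /eqP : C' ^+ 2 = C ^+ 2 by rewrite -[C'](divfK Cn0) exprMn CC mul1r.
    by rewrite eqf_sqr => /orP[] /eqP; [left|right].
  congr EFin; rewrite expr_div_n.
  by case: CC => ->; rewrite ?sqrrN divff // expf_neq0.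
exists nu; split; last exact: density_fourier_space_measure.
rewrite -wE; exact: density_probabilityP.
Qed.

End FourierSpaceMeasureOfTanhJacobi.

Theorem theorem4p1 (R : realType) (alpha beta : R)
    (alpha_gt : -1 < alpha) (beta_gt : -1 < beta) :
  exists C : R,
    (forall C' : R,
       (\int[@lebesgue_measure R]_(xi in [set: R])
          (gamma_weight alpha beta C' xi)%:E)%E = 1%:E
       <-> C' = C \/ C' = - C) /\
    exists mu : probability (measurableTypeR R) R,
      has_density mu (gamma_weight alpha beta C) /\
      is_fourier_space_measure (tanh_jacobi alpha beta) mu.
Proof.
have a0 : 0 < (alpha + 1) / 2 by rewrite divr_gt0 // -ltrBlDr sub0r.
have b0 : 0 < (beta + 1) / 2 by rewrite divr_gt0 // -ltrBlDr sub0r.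
have := tanh_jacobi_fourier_space_measure a0 b0.
have -> : 2 * ((alpha + 1) / 2) - 1 = alpha by field.
by have -> : 2 * ((beta + 1) / 2) - 1 = beta by field.
Qed.
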